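(* Let $K$ be a field of characteristic zero and let $\sigma\in S_n$ be an involution ($\sigma^2=\mathrm{id}$). For every $f\in X_\sigma$ the dimension of the coadjoint orbit $\Omega(f)$ equals $l(\sigma)-s(\sigma)$.
   Context: $N=\mathrm{UT}(n,K)$ is the group of lower triangular $n\times n$ matrices over $K$ with ones on the diagonal, and $\mathfrak{n}=\mathfrak{ut}(n,K)$ is its Lie algebra of strictly lower triangular matrices, with standard basis $y_{ij}$ ($1\le j<i\le n$, the matrix unit with $1$ in row $i$, column $j$). $N$ acts on the dual space $\mathfrak{n}^*$ by $(\mathrm{Ad}^*_g f)(x)=f(\mathrm{Ad}_g^{-1}x)$, where $\mathrm{Ad}_g x=gxg^{-1}$; $\Omega(f)$ is the orbit of $f$ under this (coadjoint) action. $\Delta^+=\{\varepsilon_j-\varepsilon_i : 1\le j<i\le n\}$ is the set of positive roots of $\mathfrak{gl}(n,K)$; for $\xi=\varepsilon_j-\varepsilon_i\in\Delta^+$ put $j(\xi)=j$, $i(\xi)=i$, $y_\xi=y_{ij}$, and let $r_\xi\in S_n$ be the transposition (reflection) $(j,i)$. The involution decomposes uniquely as a product of commuting reflections $\sigma=r_1\cdots r_s$, $r_m=r_{\xi_m}$, $\xi_m\in\Delta^+$, numbered so that $j(\xi_1)<\dots<j(\xi_s)$. Put $\mathcal{S}=\{\xi_1,\dots,\xi_s\}$. $X_\sigma\subset\mathfrak{n}^*$ is the set of all $f$ with $f(y_{\xi_m})\neq0$ for $1\le m\le s$ and $f(y_\gamma)=0$ for all $\gamma\in\Delta^+\setminus\mathcal{S}$.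 $l(\sigma)$ (resp. $s(\sigma)$) is the number of factors in a reduced (shortest) decomposition of $\sigma$ into a product of simple reflections $(k,k+1)$ (resp. of arbitrary reflections, i.e. transpositions); one has $s(\sigma)=s$. *)

(* Defs.v *)
From HB Require Import structures.
From mathcomp Require Import all_boot all_order all_algebra all_fingroup.
From mathcomp Require Import mpoly.

Set Implicit Arguments.
Unset Strict Implicit.
Unset Printing Implicit Defensive.

Import GRing.Theory.
Local Open Scope ring_scope.

(* The pair (j, i) with j < i stands for the root eps_j - eps_i. *)
Definition posroot (n : nat) := {p : 'I_n * 'I_n | (p.1 < p.2)%N}.

Definition root_j n (xi : posroot n) : 'I_n := (val xi).1.
Definition root_i n (xi : posroot n) : 'I_n := (val xi).2.

Definition reflection n (xi : posroot n) : 'S_n := tperm (root_j xi) (root_i xi).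

Definition reflections n : {set 'S_n} := [set reflection xi | xi : posroot n].

Definition simple_reflections n : {set 'S_n} :=
  [set reflection xi | xi : posroot n & root_i xi == (root_j xi).+1 :> nat].

Definition has_word n (R : {set 'S_n}) (s : 'S_n) (k : nat) : bool :=
  [exists w : k.-tuple 'S_n,
     all (mem R) w && ((\prod_(t <- w) t)%g == s)].

Lemma has_word_gen n (R : {set 'S_n}) s :
  s \in <<R>>%g -> exists k, has_word R s k.
Proof.
move=> /gen_prodgP[k [c cR ->]]; exists k; apply/existsP.
exists [tuple c i | i < k]; apply/andP; split.
  by apply/allP => t /mapP[i _ ->]; exact: cR.
by rewrite big_tuple; apply/eqP/eq_bigr => i _; rewrite tnth_mktuple.
Qed.

Lemma gen_simple n (s : 'S_n) : s \in <<simple_reflections n>>%g.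
Proof.
have adj (i j : 'I_n) : j = i.+1 :> nat ->
    tperm i j \in <<simple_reflections n>>%g.
  move=> ji; apply: mem_gen; apply/imsetP.
  have ij : ((i, j).1 < (i, j).2)%N by rewrite /= ji.
  by exists (Sub (i, j) ij) => //; rewrite inE /root_i /root_j SubK /= ji.
have far d : forall i j : 'I_n, j = (i + d.+1)%N :> nat ->
    tperm i j \in <<simple_reflections n>>%g.
  elim: d => [|d IHd] i j jE; first by apply: adj; rewrite jE addn1.
  have kn : (i + d.+1 < n)%N.
    by apply: leq_trans (ltn_ord j); rewrite jE ltnS leq_add2l.
  pose k := Ordinal kn.
  have -> : tperm i j = (tperm i k ^ tperm k j)%g.
    rewrite tpermJ tpermL tpermD //.
      by rewrite -val_eqE /= -{2}[val i]addn0 eqn_add2l.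
    by rewrite -val_eqE /= jE -{2}[val i]addn0 eqn_add2l.
  by apply: groupJ; [exact: IHd | apply: adj; rewrite jE /= !addnS].
have all_tperm (i j : 'I_n) : tperm i j \in <<simple_reflections n>>%g.
  wlog le_ij : i j / (i <= j)%N.
    by move=> W; have [/W //|/ltnW/W] := leqP i j; rewrite tpermC.
  case: (eqVneq i j) => [->|ne]; first by rewrite tperm1 group1.
  have lt_ij : (i < j)%N by rewrite ltn_neqAle ne.
  by apply: (far (j - i.+1)%N); rewrite addnS -addSn subnKC.
have [ts -> _] := prod_tpermP s.
by apply: group_prod => t _; exact: all_tperm.
Qed.

Lemma simple_sub_reflections n : simple_reflections n \subset reflections n.
Proof.
by apply/subsetP => _ /imsetP[xi _ ->]; apply: imset_f.
Qed.

Lemma simple_word n (s : 'S_n) : exists k, has_word (simple_reflections n) s k.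
Proof. exact/has_word_gen/gen_simple. Qed.

Lemma reflection_word n (s : 'S_n) : exists k, has_word (reflections n) s k.
Proof.
apply: has_word_gen.
exact: subsetP (genS (simple_sub_reflections n)) _ (gen_simple s).
Qed.

(* l(s) and s(s): least number of factors in a word for s in the simple
   reflections, resp. in all reflections. *)
Definition simple_length n (s : 'S_n) : nat := ex_minn (simple_word s).
Definition reflection_length n (s : 'S_n) : nat := ex_minn (reflection_word s).

(* Hence the truncated difference l(s) - s(s) is the true one. *)
Lemma reflection_length_le n (s : 'S_n) :
  (reflection_length s <= simple_length s)%N.
Proof.
rewrite /simple_length; case: ex_minnP => k /existsP[w /andP[ws wE]] _.
rewrite /reflection_length; case: ex_minnP => m _; apply; apply/existsP.
exists w; rewrite wE andbT; apply: sub_all ws => t.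
exact: (subsetP (simple_sub_reflections n)).
Qed.

(* xi_1, ..., xi_s numbered by increasing j; strict increase makes them
   distinct. *)
Definition reflection_decomposition n (s : 'S_n) (xis : seq (posroot n)) :=
  [/\ sorted (fun xi eta => (root_j xi < root_j eta)%N) xis,
      {in xis &, forall xi eta, commute (reflection xi) (reflection eta)}
    & s = (\prod_(xi <- xis) reflection xi)%g].

Section Coadjoint.
Variables (n : nat) (K : fieldType).

Definition ut : {vspace 'M[K]_n} :=
  <<[seq delta_mx (root_i xi) (root_j xi) | xi : posroot n]>>%VS.

Lemma mem_utP (x : 'M[K]_n) :
  reflect (forall i j : 'I_n, (i <= j)%N -> x i j = 0) (x \in ut).
Proof.
apply: (iffP idP) => [xut i j le_ij|x0].
  rewrite (coord_span (X := in_tuple _) xut) summxE big1 // => k _.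
  rewrite mxE; have /mapP[xi _ ->] : (in_tuple
    [seq delta_mx (root_i xi) (root_j xi) | xi : posroot n])`_k \in
    [seq (delta_mx (root_i xi) (root_j xi) : 'M[K]_n) | xi : posroot n].
    exact: mem_nth.
  rewrite mxE; case: eqP => [ei|]; last by rewrite mulr0.
  case: eqP => [ej|]; last by rewrite mulr0.
  by have := valP xi; rewrite -/(root_i xi) -/(root_j xi) -ei -ej ltnNge le_ij.
rewrite [x]matrix_sum_delta; apply: memv_suml => i _; apply: memv_suml => j _.
have [/x0->|lt_ji] := leqP i j; first by rewrite scale0r mem0v.
apply/memvZ/memv_span/mapP.
by exists (Sub (j, i) lt_ji : posroot n); rewrite ?mem_enum.
Qed.

Definition UT : {pred 'M[K]_n} :=
  [pred g : 'M[K]_n |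
    [forall i : 'I_n, forall j : 'I_n, (i <= j)%N ==> (g i j == (i == j)%:R)]].

Lemma UTP (g : 'M[K]_n) :
  reflect (forall i j : 'I_n, (i <= j)%N -> g i j = (i == j)%:R) (g \in UT).
Proof.
apply: (iffP forallP) => [H i j le_ij|H i]; last first.
  by apply/forallP => j; apply/implyP => /H/eqP.
by apply/eqP; move: (forallP (H i) j) => /implyP; exact.
Qed.

Lemma UT_unit (g : 'M[K]_n) : g \in UT -> g \in unitmx.
Proof.
move=> /UTP gU; rewrite unitmxE det_trig.
  by rewrite big1 ?unitr1 // => i _; rewrite gU ?eqxx.
apply/is_trig_mxP => i j lt_ij; rewrite gU 1?ltnW //.
by rewrite -val_eqE ltn_eqF.
Qed.

Local Notation nilp := (subvs_of ut).

Definition ydelta (xi : posroot n) : nilp :=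
  vsproj ut (delta_mx (root_i xi) (root_j xi)).

Lemma ydeltaE xi : vsval (ydelta xi) = delta_mx (root_i xi) (root_j xi).
Proof. by rewrite vsprojK //; apply/memv_span/mapP; exists xi; rewrite ?mem_enum. Qed.

(* For g in UT the projection vsproj does nothing: see Ad_valE. *)
Definition conj_ut (g : 'M[K]_n) (x : nilp) : nilp :=
  vsproj ut (g *m vsval x *m invmx g).

Fact conj_ut_is_linear g : linear (conj_ut g).
Proof.
move=> a x y; rewrite /conj_ut -linearP; congr vsproj.
by rewrite linearP mulmxDl -scalemxAl.
Qed.
HB.instance Definition _ g := GRing.isLinear.Build K nilp nilp _ (conj_ut g)
  (conj_ut_is_linear g).

Definition Ad (g : 'M[K]_n) : 'End(nilp) := linfun (conj_ut g).

Lemma mul_UT_ut (g x : 'M[K]_n) : g \in UT -> x \in ut -> g *m x \in ut.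
Proof.
move=> /UTP gU /mem_utP xu; apply/mem_utP => i j le_ij.
rewrite mxE big1 // => k _; have [le_kj|lt_jk] := leqP k j.
  by rewrite xu ?mulr0.
have lt_ik : (i < k)%N by exact: leq_ltn_trans lt_jk.
by rewrite gU 1?ltnW // -val_eqE (ltn_eqF lt_ik) mul0r.
Qed.

Lemma mul_ut_UT (g x : 'M[K]_n) : g \in UT -> x \in ut -> x *m g \in ut.
Proof.
move=> /UTP gU /mem_utP xu; apply/mem_utP => i j le_ij.
rewrite mxE big1 // => k _; have [le_ik|lt_ki] := leqP i k.
  by rewrite xu ?mul0r.
have lt_kj : (k < j)%N by exact: leq_trans le_ij.
by rewrite gU 1?ltnW // -val_eqE (ltn_eqF lt_kj) mulr0.
Qed.

Lemma UT_inv (g : 'M[K]_n) : g \in UT -> invmx g \in UT.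
Proof.
move=> gU; have gu := UT_unit gU.
have g1 : 1%:M - g \in ut.
  apply/mem_utP => i j le_ij; rewrite !mxE (UTP _ gU) //.
  by rewrite subrr.
(* right multiplication by g is injective on ut, hence onto *)
have inj : lker (linfun (mulmxr g) : 'End('M[K]_n)) == 0%VS.
  apply/lker0P => a b; rewrite !lfunE /= => /(congr1 (mulmx^~ (invmx g))).
  by rewrite !mulmxK.
have img : (linfun (mulmxr g) @: ut)%VS = ut.
  apply/eqP; rewrite eqEdim limg_dim_eq; last by rewrite (eqP inj) capv0.
  rewrite leqnn andbT; apply/subvP => _ /memv_imgP[x xu ->].
  by rewrite lfunE /=; apply: mul_ut_UT.
have [x xu] : exists2 x, x \in ut & 1%:M - g = x *m g.
  by move: g1; rewrite -{1}img => /memv_imgP[x xu ->]; exists x; rewrite ?lfunE.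
move=> xE; have -> : invmx g = 1%:M + x.
  rewrite -[RHS](mulmxK gu) mulmxDl -xE mul1mx addrC subrK.
  by rewrite mul1mx.
by apply/UTP => i j le_ij; rewrite !mxE (mem_utP _ xu) ?addr0.
Qed.

Lemma Ad_valE g x : g \in UT -> vsval (Ad g x) = g *m vsval x *m invmx g.
Proof.
move=> gU; rewrite lfunE /= vsprojK //.
by apply: mul_ut_UT; [exact: UT_inv | apply: mul_UT_ut => //; exact: subvsP].
Qed.

Local Notation nilp_dual := 'Hom(nilp, K^o).

(* Ad_g^{-1} = Ad_{g^{-1}}. *)
Definition coAd (g : 'M[K]_n) (f : nilp_dual) : nilp_dual :=
  (f \o Ad (invmx g))%VF.

Definition orbit_coAd (f : nilp_dual) : nilp_dual -> Prop :=
  fun h => exists2 g, g \in UT & h = coAd g f.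

Definition Xset (s : 'S_n) (f : nilp_dual) : Prop :=
  exists xis : seq (posroot n),
    [/\ reflection_decomposition s xis,
        forall xi, xi \in xis -> f (ydelta xi) != 0
      & forall xi, xi \notin xis -> f (ydelta xi) = 0].

End Coadjoint.

Notation nilp n K := (subvs_of (ut n K)).
Notation nilp_dual n K := 'Hom(nilp n K, K^o).

(* Krull dimension of A : V -> Prop with the subspace topology induced by the
   Zariski topology of the K-points of V. *)

Section Zariski.
Variables (K : fieldType) (V : vectType K).
Implicit Types (A C Z : V -> Prop).

Definition subset_of A C := forall x, A x -> C x.

(* Another basis would give the same set of functions. *)
Definition polyfun (p : {mpoly K[\dim {:V}]}) (x : V) : K :=
  p.@[fun k => coord (vbasis {:V}) k x].

Definition zariski_closed Z :=
  exists P : {mpoly K[\dim {:V}]} -> Prop,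
    forall x, Z x <-> (forall p, P p -> polyfun p x = 0).

Definition closed_in A Z :=
  exists2 C, zariski_closed C & forall x, Z x <-> A x /\ C x.

Definition irreducible Z :=
  (exists x, Z x) /\
  forall C1 C2, zariski_closed C1 -> zariski_closed C2 ->
    (forall x, Z x -> C1 x \/ C2 x) -> subset_of Z C1 \/ subset_of Z C2.

(* Z_0 < Z_1 < ... < Z_d, irreducible closed subsets of A. *)
Definition irreducible_chain A (d : nat) (Z : nat -> V -> Prop) :=
  (forall i, (i <= d)%N -> closed_in A (Z i) /\ irreducible (Z i)) /\
  (forall i, (i < d)%N -> subset_of (Z i) (Z i.+1) /\ ~ subset_of (Z i.+1) (Z i)).

Definition krull_dim A (d : nat) :=
  (exists Z : nat -> V -> Prop, irreducible_chain A d Z) /\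
  (forall m (Z : nat -> V -> Prop), irreducible_chain A m Z -> (m <= d)%N).

End Zariski.

(* Main.v *)
From HB Require Import structures.
Require Import Defs.
From mathcomp Require Import all_boot all_order all_algebra all_fingroup.
From mathcomp Require Import mpoly zify ring.
From Stdlib Require Import Classical.

(** Identify a linear form f on the strictly lower triangular matrices with
the strictly upper triangular matrix F such that f x = tr (F x).  Then g acts
by sending F to the strictly upper triangular part of g F g^-1 ([upper],
[dual_mx_coAd]), and the f of the theorem becomes a sum of w_m E_(j_m, i_m)
with all w_m nonzero ([arcs_mx]).  The pair (j_m, i_m) is drawn as an arc
from j_m to i_m; since the reflections commute, distinct arcs share no
endpoint.

The orbit is an affine space, and its coordinates appear by removing the arc
(j, i) with smallest j.  Let N be the number of indices strictly between j
and i, and write p for row i of g^-1 and q for column j of g.  Row j of the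
orbit matrix X is w p, so that p is free at the N indices between j and i;
using this row one can clear column i, whose N entries strictly between rows
j and i are again free.  What remains, X r c - X r i * X j c / w on the
indices r, c beyond j other than i, is an arbitrary point of the orbit of the
shorter arc system on these indices ([orbit_unglue], [orbit_glue]), and X is
recovered from it and from the 2 N free entries by polynomials
([glue_unglue]).  By induction the orbit is the isomorphic image of K^d with
d the sum of 2 N over the successive arcs, N counting each time the indices
that are still present ([orbit_mx_chart], [arcs_dim]).

The same induction counts inversions.  Removing the arc (j, i) from the
involution destroys the inversion (j, i) itself, N inversions involving j and
N involving i, so an involution with s arcs has d + s inversions
([card_inversions]).  The number of inversions is the Coxeter length
([simple_length_inversions]), and s is the reflection length because a
product of k transpositions moves at most 2 k points
([reflection_length_arcs]).  Hence l - s = d.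

It remains that a set polynomially isomorphic to K^d has Krull dimension d
when K is infinite ([krull_dim_param]); K need not be algebraically closed,
so this is done with K-points throughout.  The coordinate subspaces of K^d
give a chain of length d: their images are irreducible because two
polynomials that are nonzero at points a and b are both nonzero somewhere on
the line through a and b ([slice_irreducible]).  Conversely, choosing in a
chain Z_0 < ... < Z_m a polynomial that vanishes on Z_(k-1) but not on Z_k,
for each k, yields m polynomials algebraically independent on Z_m
([chain_alg_indep]); pulled back to K^d they are m independent polynomials in
d variables, and counting monomials gives m <= d ([algebraic_dependence]). *)

Set Implicit Arguments.
Unset Strict Implicit.
Unset Printing Implicit Defensive.

(** * Arc systems, inversions and lengths *)

Section Arcs.
Variable n : nat.
Implicit Types (xi eta : posroot n) (xs : seq (posroot n)) (A : {set 'I_n}) (s t : 'S_n).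

Lemma root_lt xi : root_j xi < root_i xi.
Proof. exact: valP xi. Qed.

(** The left ends increase and the arcs share no endpoint; the remaining
inequality, between the left end of the first arc and the right end of the
second, follows from the increase. *)
Definition arc_before xi eta :=
  [&& root_j xi < root_j eta, root_i xi != root_j eta & root_i xi != root_i eta].

Definition arcs_on A xs :=
  pairwise arc_before xs && all (fun xi => (root_j xi \in A) && (root_i xi \in A)) xs.

(** The indices on which the later arcs live once xi, the arc of smallest
left end, has been removed.  Indices left of xi are dropped too: they meet no
arc. *)
Definition arc_rest A xi := [set k in A | (root_j xi < k) && (k != root_i xi)].

Definition arc_gap A xi := [set k in A | root_j xi < k < root_i xi].

Definition arc_perm xs : 'S_n := (\prod_(xi <- xs) reflection xi)%g.

Lemma arcs_on_cons A xi xs : arcs_on A (xi :: xs) ->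
  [/\ root_j xi \in A, root_i xi \in A & arcs_on (arc_rest A xi) xs].
Proof.
rewrite /arcs_on /= => /and3P[/andP[/allP before ->] /andP[-> ->] /allP inA].
split=> //=; apply/allP => eta eta_xs.
have /and3P[jj ij ii] := before _ eta_xs; have /andP[jA iA] := inA _ eta_xs.
rewrite !inE jA iA jj eq_sym ij eq_sym ii !andbT /=.
exact: ltn_trans (root_lt eta).
Qed.

Lemma arc_perm_on A xs : arcs_on A xs -> perm_on A (arc_perm xs).
Proof.
case/andP=> _; elim: xs => [|xi xs IH] /=; first by rewrite /arc_perm big_nil perm_on1.
case/andP=> /andP[jA iA] /IH; rewrite /arc_perm big_cons; apply: perm_onM.
apply/subsetP => x; rewrite inE /reflection; case: tpermP => [->|->|] //.
by move=> _ _; rewrite eqxx.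
Qed.

Lemma arc_permP A xi xs (x : 'I_n) : arcs_on A (xi :: xs) -> x \in A ->
  [\/ [/\ x < root_j xi, arc_perm (xi :: xs) x = x & x \notin arc_rest A xi],
      [/\ x = root_j xi, arc_perm (xi :: xs) x = root_i xi,
          arc_perm xs x = x & x \notin arc_rest A xi],
      [/\ x = root_i xi, arc_perm (xi :: xs) x = root_j xi,
          arc_perm xs x = x & x \notin arc_rest A xi]
    | [/\ x \in arc_rest A xi, arc_perm (xi :: xs) x = arc_perm xs x
        & arc_perm xs x \in arc_rest A xi]].
Proof.
move=> /arcs_on_cons[jA iA on'] xA; have pon := arc_perm_on on'.
have fixed y : y \notin arc_rest A xi -> arc_perm xs y = y by apply: out_perm pon.
have jn : root_j xi \notin arc_rest A xi by rewrite inE ltnn andbF.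
have in_ : root_i xi \notin arc_rest A xi by rewrite inE eqxx !andbF.
have E y : arc_perm (xi :: xs) y = arc_perm xs (reflection xi y).
  by rewrite /arc_perm big_cons permM.
rewrite E /reflection; case: tpermP => [->|->|xj xi'].
- by constructor 2; rewrite !fixed.
- by constructor 3; rewrite !fixed.
have [xlt|/ltnW|/val_inj//] := ltngtP x (root_j xi).
  have xn : x \notin arc_rest A xi by rewrite inE; lia.
  by constructor 1; rewrite fixed.
rewrite leq_eqVlt => /orP[/eqP/val_inj/esym//|xgt].
have xr : x \in arc_rest A xi by rewrite inE xA xgt /=; apply/eqP.
by constructor 4; rewrite perm_closed.
Qed.

Definition inversions A s : {set 'I_n * 'I_n} :=
  [set p | [&& p.1 \in A, p.2 \in A, p.1 < p.2 & s p.2 < s p.1]].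

(** Each arc contributes one free row and one free column over its gap.  The
gap counts only the indices still alive, so a crossing is counted for one of
its two arcs and a nested arc twice for the outer one. *)
Fixpoint arcs_dim A xs :=
  if xs is xi :: xs' then 2 * #|arc_gap A xi| + arcs_dim (arc_rest A xi) xs' else 0.

(** An arc (j, i) is inverted itself; any b that the rest sends into the gap
lands left of i, the image of j; and any k in the gap is sent right of j, the
image of i.  No other new inversion arises, since indices left of j are fixed
and indices right of j are never sent to the left of j. *)
Lemma inversions_cons A xi xs : arcs_on A (xi :: xs) ->
  inversions A (arc_perm (xi :: xs)) =
  (root_j xi, root_i xi) |:
    ([set (root_j xi, (arc_perm xs)^-1%g k) | k in arc_gap A xi] :|:
     ([set (k, root_i xi) | k in arc_gap A xi] :|:
      inversions (arc_rest A xi) (arc_perm xs))).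
Proof.
move=> on; have [jA iA on'] := arcs_on_cons on; have pon := arc_perm_on on'.
have lt := root_lt xi.
apply/setP => -[a b]; rewrite !inE /=.
have -> : ((a, b) \in [set (root_j xi, (arc_perm xs)^-1%g k) | k in arc_gap A xi]) =
    (a == root_j xi) && (arc_perm xs b \in arc_gap A xi).
  apply/imsetP/andP => [[k kg [-> ->]]|[/eqP-> bg]]; first by rewrite permKV.
  by exists (arc_perm xs b); rewrite ?permK.
have -> : ((a, b) \in [set (k, root_i xi) | k in arc_gap A xi]) =
    (b == root_i xi) && (a \in arc_gap A xi).
  apply/imsetP/andP => [[k kg [-> ->]]|[/eqP-> bg]] //.
  by exists a.
have gapA c : c \in arc_gap A xi = [&& c \in A, root_j xi < c & c < root_i xi] by rewrite inE.
have restA c : c \in arc_rest A xi = [&& c \in A, root_j xi < c & c != root_i xi] by rewrite inE.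
rewrite xpair_eqE.
have [aA|aA] := boolP (a \in A); last first.
  have /negPf-> : a != root_j xi by apply: contraNneq aA => ->.
  by rewrite !gapA (negPf aA) /= !andbF.
have [bA|bA] := boolP (b \in A); last first.
  have /negPf-> : b != root_i xi by apply: contraNneq bA => ->.
  have -> : arc_perm xs b = b by apply: out_perm pon _; rewrite restA (negPf bA).
  by rewrite !gapA (negPf bA) /= !andbF.
have key (c : 'I_n) : c \in A ->
    [/\ arc_perm xs c \in A &
    [\/ [/\ c < root_j xi, arc_perm (xi :: xs) c = c :> nat & arc_perm xs c = c :> nat],
      [/\ c = root_j xi :> nat, arc_perm (xi :: xs) c = root_i xi :> nat
        & arc_perm xs c = c :> nat],
      [/\ c = root_i xi :> nat, arc_perm (xi :: xs) c = root_j xi :> nat & arc_perm xs c = c :> nat]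
    | [/\ root_j xi < c, c <> root_i xi :> nat, arc_perm (xi :: xs) c = arc_perm xs c :> nat,
       root_j xi < arc_perm xs c & arc_perm xs c <> root_i xi :> nat]]].
  move=> cA; have := arc_permP on cA; rewrite !restA !cA /=.
  have nE (x y : 'I_n) : x != y -> x <> y :> nat by move=> /eqP ne /val_inj.
  case=> [[c1 c2 c3]|[c1 c2 c3 _]|[c1 c2 c3 _]|[/andP[c1 c2] c3 /and3P[c4 c5 c6]]].
  - have c4 : arc_perm xs c = c by apply: out_perm pon _; rewrite restA cA.
    by rewrite c2 c4; split=> //; constructor 1.
  - by rewrite c3 c2 cA -c1; split=> //; constructor 2.
  - by rewrite c3 c2 cA -c1; split=> //; constructor 3.
  - by rewrite c3; split=> //; constructor 4; split=> //; apply: nE.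
have [sA ka] := key a aA; have [sB kb] := key b bA.
rewrite !gapA -!val_eqE /= ?aA sB; case: ka => [[? ? ?]|[? ? ?]|[? ? ?]|[? ? ? ? ?]];
  case: kb => [[? ? ?]|[? ? ?]|[? ? ?]|[? ? ? ? ?]]; lia.
Qed.

Lemma card_inversions A xs : arcs_on A xs ->
  #|inversions A (arc_perm xs)| = arcs_dim A xs + size xs.
Proof.
elim: xs A => [|xi xs IH] A on.
  apply/eqP; rewrite cards_eq0; apply/eqP/setP => -[a b].
  by rewrite !inE /arc_perm big_nil !perm1 /=; lia.
have [jA iA on'] := arcs_on_cons on; have pon := arc_perm_on on'.
have lt := root_lt xi.
have fixi : arc_perm xs (root_i xi) = root_i xi.
  by apply: out_perm pon _; rewrite inE eqxx !andbF.
rewrite inversions_cons // cardsU1.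
have -> : (root_j xi, root_i xi) \notin [set (root_j xi, (arc_perm xs)^-1%g k) | k in arc_gap A xi] :|:
     ([set (k, root_i xi) | k in arc_gap A xi] :|:
      inversions (arc_rest A xi) (arc_perm xs)).
  rewrite !inE /= ltnn !andbF orbF; apply/norP; split; apply/imsetP => -[k].
    rewrite inE => /and3P[_ _ ki] [/(congr1 (arc_perm xs))]; rewrite permKV fixi => E.
    by rewrite E ltnn in ki.
  by rewrite inE => /and3P[_ jk _] [E]; rewrite E ltnn in jk.
rewrite cardsU; set X := (X in X + _ - _); set Y := [set _ | _ in _].
have -> : [set (root_j xi, (arc_perm xs)^-1%g k) | k in arc_gap A xi] :&:
   (Y :|: inversions (arc_rest A xi) (arc_perm xs)) = set0.
  apply/setP => p; rewrite !inE; apply/negP => /andP[/imsetP[k _ ->]] /=.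
  rewrite ltnn !andbF orbF => /imsetP[k']; rewrite inE => /and3P[_ jk _] [E _].
  by rewrite E ltnn in jk.
rewrite cards0 subn0 cardsU.
have -> : Y :&: inversions (arc_rest A xi) (arc_perm xs) = set0.
  apply/setP => p; rewrite !inE; apply/negP => /andP[/imsetP[k _ ->]] /=.
  by rewrite eqxx !andbF.
rewrite cards0 subn0 IH // /X /Y !card_imset; first by move=> /=; lia.
- by move=> k k' [].
- by move=> k k' [/perm_inj].
Qed.

Definition word_of (R : {set 'S_n}) s (w : seq 'S_n) :=
  all (mem R) w /\ (\prod_(t <- w) t)%g = s.

Lemma has_wordP (R : {set 'S_n}) s k :
  reflect (exists2 w, word_of R s w & size w = k) (has_word R s k).
Proof.
apply: (iffP existsP) => [[w /andP[wR /eqP ws]]|[w [wR ws] sz]].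
  by exists w; rewrite ?size_tuple.
have szw : size w == k by apply/eqP.
by exists (Tuple szw); rewrite /= wR ws eqxx.
Qed.

Definition moved s : {set 'I_n} := [set x | s x != x].

(** Two points for each transposition: this bounds the reflection length from
below. *)
Lemma moved_word w s : word_of (reflections n) s w -> #|moved s| <= 2 * size w.
Proof.
case=> wR <- {s}; elim: w wR => [|t w IH] /=.
  by rewrite big_nil => _; rewrite leqn0 cards_eq0; apply/eqP/setP => x; rewrite !inE perm1 eqxx.
case/andP=> /imsetP[xi _ ->] /IH {}IH; rewrite big_cons mulnS.
apply: leq_trans (_ : #|[set root_j xi; root_i xi] :|: moved (\prod_(t <- w) t)%g| <= _).
  apply/subset_leq_card/subsetP => x; rewrite !inE permM /reflection.
  by case: tpermP => [->|->|_ _ ->]; rewrite ?eqxx ?orbT.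
by apply: leq_trans (leq_card_setU _ _) _; rewrite leq_add // cards2; case: eqP.
Qed.

Lemma card_moved_arcs A xs : arcs_on A xs -> #|moved (arc_perm xs)| = 2 * size xs.
Proof.
elim: xs A => [|xi xs IH] A on.
  by apply/eqP; rewrite cards_eq0; apply/eqP/setP => x; rewrite !inE /arc_perm big_nil perm1 eqxx.
have [jA iA on'] := arcs_on_cons on; have pon := arc_perm_on on'.
have lt := root_lt xi.
have fixj : arc_perm xs (root_j xi) = root_j xi.
  by apply: out_perm pon _; rewrite inE ltnn !andbF.
have fixi : arc_perm xs (root_i xi) = root_i xi.
  by apply: out_perm pon _; rewrite inE eqxx !andbF.
have -> : moved (arc_perm (xi :: xs)) = root_j xi |: (root_i xi |: moved (arc_perm xs)).
  apply/setP => x; rewrite !inE /arc_perm big_cons permM -/(arc_perm xs) /reflection.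
  case: tpermP => [->|->|/eqP/negPf-> /eqP/negPf-> //]; rewrite ?fixi ?fixj eqxx ?orbT.
    by rewrite -val_eqE gtn_eqF.
  by rewrite -val_eqE ltn_eqF.
rewrite !cardsU1 !inE fixi fixj !eqxx /= -val_eqE ltn_eqF //= (IH _ on'); lia.
Qed.

Lemma reflection_length_arcs xs : arcs_on setT xs ->
  reflection_length (arc_perm xs) = size xs.
Proof.
move=> on; rewrite /reflection_length; case: ex_minnP => k kw kmin.
apply/eqP; rewrite eqn_leq; apply/andP; split.
  apply/kmin/has_wordP; exists (map (@reflection n) xs); last by rewrite size_map.
  split; last by rewrite big_map.
  by apply/allP => _ /mapP[xi _ ->]; apply: imset_f.
have [w ww <-] := has_wordP _ _ _ kw.
by rewrite -(leq_pmul2l (_ : 0 < 2)) // -(card_moved_arcs on); apply: moved_word.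
Qed.

Lemma simple_reflectionP t :
  reflect (exists u v : 'I_n, v = u.+1 :> nat /\ t = tperm u v)
          (t \in simple_reflections n).
Proof.
apply: (iffP imsetP) => [[xi]|[u [v [uv ->]]]].
  by rewrite inE => /eqP E ->; exists (root_j xi), (root_i xi).
have lt : (u, v).1 < (u, v).2 by rewrite /= uv.
exists (Sub (u, v) lt); first by rewrite inE /root_i /root_j SubK /= uv.
by rewrite /reflection /root_i /root_j SubK.
Qed.

(** Exchanging two adjacent values changes the order of no pair of values
other than the exchanged one. *)
Lemma tperm_adjacent_lt (u v x y : 'I_n) : v = u.+1 :> nat ->
  tperm u v y < tperm u v x ->
  (y < x) && ~~ ((x == v) && (y == u)) || (x == u) && (y == v).
Proof.
move=> uv.
have nE (a b : 'I_n) : a <> b -> a <> b :> nat by move=> ne /val_inj.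
have tE (a : 'I_n) : [\/ a = u :> nat /\ tperm u v a = v :> nat,
    a = v :> nat /\ tperm u v a = u :> nat
  | [/\ a <> u :> nat, a <> v :> nat & tperm u v a = a :> nat]].
  case: tpermP => [->|->|/nE au /nE av]; first by constructor 1.
    by constructor 2.
  by constructor 3.
rewrite -!val_eqE /=.
case: (tE x) => [[? ->]|[? ->]|[? ? ->]]; case: (tE y) => [[? ->]|[? ->]|[? ? ->]]; lia.
Qed.

Local Notation inv s := (#|inversions setT s|).

(** The only possible new inversion is the pair of positions of the two
adjacent values that t exchanges. *)
Lemma inv_simple_le s t : t \in simple_reflections n -> inv (s * t)%g <= (inv s).+1.
Proof.
case/simple_reflectionP=> u [v [uv ->]].
apply: leq_trans (_ : #|((s^-1)%g u, (s^-1)%g v) |: inversions setT s| <= _); last first.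
  by rewrite cardsU1 -[_.+1]add1n leq_add2r leq_b1.
apply/subset_leq_card/subsetP => -[a b]; rewrite !inE /= !permM => /andP[-> /=].
move/(tperm_adjacent_lt uv)=> /orP[/andP[-> _]|/andP[/eqP<- /eqP<-]]; first by rewrite orbT.
by rewrite !permK eqxx.
Qed.

Lemma inv_simple_lt s (u v : 'I_n) : v = u.+1 :> nat ->
  (s^-1%g v < s^-1%g u) -> inv (s * tperm u v)%g < inv s.
Proof.
move=> uv lt; apply: proper_card; apply/properP; split.
  apply/subsetP => -[a b]; rewrite !inE /= !permM => /andP[ab].
  move/(tperm_adjacent_lt uv)=> /orP[/andP[-> _]|/andP[/eqP ea /eqP eb]]; first by rewrite ab.
  by move: lt; rewrite -ea -eb !permK; lia.
exists ((s^-1)%g v, (s^-1)%g u); rewrite !inE /= lt ?permM ?permKV ?tpermL ?tpermR //=; lia.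
Qed.

(** Such a permutation and its inverse are increasing, so each lies above
the identity. *)
Lemma perm_no_descent s :
  (forall u v : 'I_n, v = u.+1 :> nat -> s u < s v) -> s = 1%g.
Proof.
move=> adj.
have mono d : forall u v : 'I_n, v = u + d.+1 :> nat -> s u < s v.
  elim: d => [|d IHd] u v vE; first by apply: adj; lia.
  have wn : u + d.+1 < n by have := ltn_ord v; lia.
  apply: ltn_trans (IHd u (Ordinal wn) _) (adj _ _ _) => //=; lia.
have ge (r : 'S_n) : (forall u v : 'I_n, u < v -> r u < r v) -> forall u : 'I_n, u <= r u.
  move=> rm [u un]; elim: u un => [//|u IHu] un.
  have un' : u < n by apply: ltnW.
  by apply: leq_ltn_trans (IHu un') (rm _ _ _) => /=.
have sm (u v : 'I_n) : u < v -> s u < s v.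
  by move=> uv; apply: (mono (v - u.+1)); lia.
have sVm (u v : 'I_n) : u < v -> s^-1%g u < s^-1%g v.
  move=> uv; have [//|lt|/val_inj/perm_inj E] := ltngtP (s^-1%g u) (s^-1%g v).
    by move/sm: lt; rewrite !permKV; lia.
  by rewrite E ltnn in uv.
apply/permP => u; rewrite perm1; apply/val_inj/eqP; rewrite eqn_leq.
by rewrite [X in _ && X]ge // andbT; have := ge _ sVm (s u); rewrite permK.
Qed.

(** Each simple factor creates at most one inversion; conversely, as long as
the permutation is not the identity, some pair of adjacent values is inverted
and exchanging it removes an inversion. *)
Lemma simple_length_inversions s : simple_length s = inv s.
Proof.
rewrite /simple_length; case: ex_minnP => k kw kmin.
apply/eqP; rewrite eqn_leq; apply/andP; split.
  suff [w ww wk] : exists2 w, word_of (simple_reflections n) s w & size w <= inv s.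
    by apply: leq_trans wk; apply/kmin/has_wordP; exists w.
  have [m] := ubnP (inv s); elim: m s {k kw kmin} => // m IHm s sm.
  have [/existsP[u /existsP[v /andP[/eqP uv lt]]]|nodesc] :=
    boolP [exists u : 'I_n, exists v : 'I_n, (v == u.+1 :> nat) && (s^-1%g v < s^-1%g u)].
    have inv_lt := inv_simple_lt uv lt.
    have [|w [wR ws] wk] := IHm (s * tperm u v)%g; first exact: leq_trans inv_lt _.
    exists (rcons w (tperm u v)); last by rewrite size_rcons (leq_ltn_trans wk).
    split; last by rewrite big_rcons /= ws -mulgA tperm2 mulg1.
    rewrite all_rcons wR andbT; apply/simple_reflectionP.
    by exists u, v.
  have s1 : (s^-1)%g = 1%g.
    apply: perm_no_descent => u v uv; rewrite ltnNge leq_eqVlt negb_or.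
    move: nodesc; rewrite negb_exists => /forallP/(_ u); rewrite negb_exists.
    move=> /forallP/(_ v); rewrite uv eqxx /= => ->; rewrite andbT.
    by apply/eqP => /val_inj/perm_inj E; move: uv; rewrite E; lia.
  by exists [::] => //; split=> //; rewrite big_nil -[s]invgK s1 invg1.
have [w [wR <-] <-] := has_wordP _ _ _ kw.
elim/last_ind: w wR => [|w t IHw] wR.
  rewrite big_nil leqn0 cards_eq0; apply/eqP/setP => -[a b].
  by rewrite !inE !perm1 /=; lia.
move: wR; rewrite all_rcons => /andP[tR /IHw {}IHw].
by rewrite big_rcons size_rcons /=; apply: leq_trans (inv_simple_le _ tR) _; rewrite ltnS.
Qed.

Lemma length_diff_arcs xs : arcs_on setT xs ->
  simple_length (arc_perm xs) - reflection_length (arc_perm xs) = arcs_dim setT xs.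
Proof.
move=> on; rewrite simple_length_inversions reflection_length_arcs //.
by rewrite card_inversions // addnK.
Qed.

(** Evaluate the two products at a, which the second transposition fixes: it
must then fix b as well. *)
Lemma tperm_commute_disjoint (a b c d : 'I_n) : a < b -> c < d -> a < c ->
  commute (tperm a b) (tperm c d) -> (b != c) && (b != d).
Proof.
move=> ab cd ac com.
have ne (x y : 'I_n) : x < y -> x != y by move=> xy; rewrite -val_eqE ltn_eqF.
have ad : a < d by apply: ltn_trans cd.
have := congr1 (fun s : 'S_n => s a) com; rewrite !permM tpermL.
rewrite [tperm c d a]tpermD ?tpermL; try by rewrite eq_sym ne.
apply: contra_eqT; rewrite negb_and !negbK => /orP[]/eqP->.
  by rewrite tpermL eq_sym ne.
by rewrite tpermR ne.
Qed.

Lemma reflection_decomposition_arcs s xs :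
  reflection_decomposition s xs -> arcs_on setT xs /\ s = arc_perm xs.
Proof.
case=> srt com ->; split=> //; apply/andP; split; last by apply/allP => xi _; rewrite !inE.
have tr : transitive (fun xi eta : posroot n => root_j xi < root_j eta).
  by move=> a b c; apply: ltn_trans.
move: srt; rewrite sorted_pairwise //.
elim: xs com => //= xi xs IH com /andP[/allP before pw]; apply/andP; split; last first.
  by apply: IH pw => a b aX bX; apply: com; rewrite inE ?aX ?bX orbT.
apply/allP => eta etaX; rewrite /arc_before before //=.
apply: tperm_commute_disjoint (root_lt xi) (root_lt eta) (before _ etaX) _.
by apply: com; rewrite inE ?eqxx ?etaX ?orbT.
Qed.

End Arcs.

(** * Algebraic dependence of d + 1 polynomials in d variables *)

Import GRing.Theory.
Local Open Scope ring_scope.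

Section Coefficients.
Variable K : fieldType.

(** The value at ps of the polynomial with coefficient family c, as a nested
sum with one exponent below N for each entry of ps.  Indexing the monomials
by sequences of exponents lets the number of indeterminates vary along an
induction. *)
Fixpoint eval_coefs (A : comAlgType K) N (ps : seq A) (c : seq nat -> K) : A :=
  if ps is p :: ps' then
    \sum_(a < N) p ^+ a * eval_coefs N ps' (fun s => c (nat_of_ord a :: s))
  else (c [::])%:A.

Definition exponents N k (s : seq nat) := (size s == k) && all (ltn^~ N) s.

Lemma eq_eval_coefs (A : comAlgType K) N (ps : seq A) c1 c2 :
  c1 =1 c2 -> eval_coefs N ps c1 = eval_coefs N ps c2.
Proof.
elim: ps c1 c2 => [|p ps IH] c1 c2 E /=; first by rewrite E.
by apply: eq_bigr => a _; congr (_ * _); apply: IH => s; apply: E.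
Qed.

Lemma eval_coefs_eq0 (A : comAlgType K) N (ps : seq A) c :
  (forall s, exponents N (size ps) s -> c s = 0) -> eval_coefs N ps c = 0.
Proof.
elim: ps c => [|p ps IH] c c0 /=; first by rewrite c0 ?scale0r.
apply: big1 => a _; rewrite IH ?mulr0 // => s /andP[/eqP sz sN].
by apply: c0; rewrite /exponents /= sz eqxx ltn_ord.
Qed.

Lemma eval_coefs_linear (A : comAlgType K) N (ps : seq A) k c1 c2 :
  eval_coefs N ps (fun s => k * c1 s + c2 s) = k *: eval_coefs N ps c1 + eval_coefs N ps c2.
Proof.
elim: ps c1 c2 => [|p ps IH] c1 c2 /=; first by rewrite scalerDl scalerA.
rewrite scaler_sumr -big_split /=; apply: eq_bigr => a _.
by rewrite IH mulrDr scalerAr.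
Qed.

Lemma eval_coefs_morph (A B : comAlgType K) (h : {lrmorphism A -> B}) N (ps : seq A) c :
  h (eval_coefs N ps c) = eval_coefs N (map h ps) c.
Proof.
elim: ps c => [|p ps IH] c /=; first by rewrite linearZ /= rmorph1.
by rewrite rmorph_sum; apply: eq_bigr => a _; rewrite rmorphM rmorphXn /= IH.
Qed.

Lemma msizeM_bound d (p q : {mpoly K[d]}) a b :
  (msize p <= a.+1)%N -> (msize q <= b.+1)%N -> (msize (p * q) <= (a + b).+1)%N.
Proof.
move=> pa qb; have [->|p0] := eqVneq p 0; first by rewrite mul0r msize0.
have [->|q0] := eqVneq q 0; first by rewrite mulr0 msize0.
rewrite msizeM //; apply: leq_trans (_ : (a.+1 + b.+1).-1 <= _)%N; last by rewrite addnS addSn.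
by rewrite -!subn1 leq_sub2r // leq_add.
Qed.

Lemma msize_eval_coefs d N D (ps : seq {mpoly K[d]}) c :
  all (fun p => msize p <= D.+1)%N ps ->
  (msize (eval_coefs N ps c) <= (size ps * (N * D)).+1)%N.
Proof.
elim: ps c => [|p ps IH] c /=; first by move=> _; rewrite alg_mpolyC msizeC; case: eqP.
case/andP=> pD psD; apply: leq_trans (msize_sum _ _ _) _.
apply/bigmax_leqP => a _; rewrite mulSn.
apply: msizeM_bound (IH _ psD).
have: (msize (p ^+ a) <= (a * D).+1)%N.
  elim: (nat_of_ord a) => [|b IHb]; first by rewrite expr0 msize1.
  by rewrite exprS mulSn; apply: msizeM_bound.
by move/leq_trans; apply; rewrite ltnS leq_mul2r ltnW ?orbT.
Qed.

(** Enough coefficients to detect a polynomial of size at most M, and only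
M ^ d of them. *)
Definition low_coefs d M (p : {mpoly K[d]}) : 'rV[K]_#|{ffun 'I_d -> 'I_M}| :=
  \row_k p@_[multinom nat_of_ord ((enum_val k : {ffun 'I_d -> 'I_M}) i) | i < d].

Lemma low_coefs_inj d M (p : {mpoly K[d]}) :
  (msize p <= M)%N -> low_coefs M p = 0 -> p = 0.
Proof.
move=> pM p0; apply/mpolyP => m; rewrite mcoeff0.
have [mM|Mm] := ltnP (mdeg m) M; last first.
  by apply: memN_msupp_eq0; apply: msize_mdeg_ge; apply: leq_trans Mm.
have mi (i : 'I_d) : (m i < M)%N.
  by apply: leq_ltn_trans mM; rewrite mdegE (bigD1 i) //= leq_addr.
move/rowP: p0 => /(_ (enum_rank [ffun i => Ordinal (mi i)])).
rewrite !mxE enum_rankK => <-; congr (_ @_ _).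
by apply/mnmP => i; rewrite mnmE ffunE.
Qed.

(** Dimension count: with exponents below N there are N ^ m monomials in the
m > d entries of ps, and their degrees are below a multiple of N, so they lie
in a space of dimension at most a constant times N ^ d. *)
Lemma algebraic_dependence d (ps : seq {mpoly K[d]}) : (d < size ps)%N ->
  exists N c s, [/\ eval_coefs N ps c = 0, exponents N (size ps) s & c s != 0].
Proof.
move=> dps; set m := size ps.
pose D := (\max_(p <- ps) msize p)%N.
have psD : all (fun p => msize p <= D.+1)%N ps.
  by apply/allP => p pps; apply: leqW; apply: leq_bigmax_seq.
(* M <= N * (m * D + 1), so this N makes M ^ d < N ^ d.+1 <= N ^ m *)
pose N := ((m * D).+1 ^ d).+1; pose M := (m * (N * D)).+1.
pose T := {: m.-tuple 'I_N}.
pose ext (v : {ffun m.-tuple 'I_N -> K^o}) (s : seq nat) : K :=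
  \sum_(e : m.-tuple 'I_N | map val e == s) v e.
pose L v := low_coefs M (eval_coefs N ps (ext v)).
have Llin : linear L.
  move=> k u v; rewrite /L.
  have -> : eval_coefs N ps (ext (k *: u + v)) = eval_coefs N ps (fun s => k * ext u s + ext v s).
    apply: eq_eval_coefs => s; rewrite /ext big_distrr -big_split /=.
    by apply: eq_bigr => e _; rewrite !ffunE.
  by rewrite eval_coefs_linear; apply/rowP => i; rewrite !mxE mcoeffD mcoeffZ.
pose Llin' := GRing.isLinear.Build K {ffun m.-tuple 'I_N -> K^o}
  'rV[K]_#|{ffun 'I_d -> 'I_M}| _ L Llin.
pose Lp : {linear {ffun m.-tuple 'I_N -> K^o} -> 'rV[K]_#|{ffun 'I_d -> 'I_M}|} := HB.pack L Llin'.
pose F := linfun Lp.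
have : lker F != 0%VS.
  rewrite -dimv_eq0 -lt0n.
  have := limg_ker_dim F fullv; rewrite capfv !dimvf => E.
  rewrite -(ltn_add2r (\dim (F @: fullv))) E add0n.
  apply: leq_ltn_trans (dimvS (subvf _)) _; rewrite dimvf /dim /= mul1n.
  rewrite card_ffun !card_ord.
  have -> : (#|{: m.-tuple 'I_N}| * 1 = N ^ m)%N by rewrite muln1 card_tuple card_ord.
  have -> : m = (m - d.+1 + d.+1)%N by rewrite subnK.
  rewrite expnD; apply: leq_trans (_ : N ^ d.+1 <= _)%N; last first.
    by rewrite leq_pmull // expn_gt0.
  have MN : (M <= N * (m * D).+1)%N.
    by rewrite /M mulnS mulnCA -addn1 addnC leq_add2r.
  apply: leq_ltn_trans (_ : (N * (m * D).+1) ^ d < _)%N.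
    by case: (d) => // d'; rewrite leq_exp2r.
  by rewrite expnMn expnSr ltn_pmul2l ?expn_gt0.
move/negP => F0; have [v vF v0] : exists2 v, v \in lker F & v != 0.
  by exists (vpick (lker F)); rewrite ?memv_pick // vpick0; apply/negP.
have [e ve] : exists e, v e != 0.
  apply/existsP; apply: contraNT v0; rewrite negb_exists => /forallP ve.
  by apply/eqP/ffunP => e; rewrite ffunE; apply/eqP; rewrite -[_ == _]negbK ve.
exists N, (ext v), (map val e); split.
- have /low_coefs_inj : low_coefs M (eval_coefs N ps (ext v)) = 0.
    by move: vF; rewrite memv_ker lfunE /= => /eqP.
  by apply; apply: msize_eval_coefs.
- rewrite /exponents size_map size_tuple eqxx /=.
  by apply/allP => _ /mapP[a _ ->]; apply: ltn_ord.
- rewrite /ext (bigD1 e) //= big1 ?addr0 // => e' /andP[/eqP E /eqP ne].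
  by case: ne; apply: val_inj; apply: inj_map E; apply: val_inj.
Qed.
End Coefficients.

(** * Krull dimension of a polynomially parametrised set *)

Section Dim.
Variables (K : fieldType) (V : vectType K).
Local Notation PV := {mpoly K[\dim {:V}]}.
Implicit Types (Z C O : V -> Prop) (p q : PV).

Definition is_polyfun (u : V -> K) := exists p, forall x, u x = polyfun p x.

Lemma zero_closed p : zariski_closed (fun x => polyfun p x = 0).
Proof. by exists (fun q => q = p) => x; split => [px q ->|->]. Qed.

Lemma irreducible_mul Z p q : irreducible Z ->
  (forall x, Z x -> polyfun (p * q) x = 0) ->
  (forall x, Z x -> polyfun p x = 0) \/ (forall x, Z x -> polyfun q x = 0).
Proof.
case=> _ Zirr pq0; apply: (Zirr _ _ (zero_closed p) (zero_closed q)) => x /pq0.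
by rewrite /polyfun mevalM => /eqP; rewrite mulf_eq0 => /orP[]/eqP; [left|right].
Qed.

Definition alg_indep_on Z (ps : seq PV) := forall N c,
  (forall x, Z x -> polyfun (eval_coefs N ps c) x = 0) ->
  forall s, exponents N (size ps) s -> c s = 0.

(** Take a relation on Z' and divide it by the highest power of p that
divides it, which is allowed since Z' is irreducible and p is not zero on it.
Restricted to Z, where p vanishes, the quotient becomes a relation between
the entries of ps alone. *)
Lemma alg_indep_cons Z Z' ps p : subset_of Z Z' -> irreducible Z' ->
  alg_indep_on Z ps -> (forall x, Z x -> polyfun p x = 0) ->
  ~ (forall x, Z' x -> polyfun p x = 0) -> alg_indep_on Z' (p :: ps).
Proof.
move=> ZZ' irr' indep p0 pn0 N c tw0 [//|a s] /=.
rewrite /exponents /= eqSS andbCA => /andP[aN sN].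
(* the coefficients at p ^ b for all b < a vanish by induction *)
elim/ltn_ind: a s aN sN => a IHa s aN sN.
pose T b := eval_coefs N ps (fun s => c (b :: s)).
have T0 b : (b < a)%N -> T b = 0.
  by move=> ba; apply: eval_coefs_eq0 => s' s'N; apply: IHa => //; apply: ltn_trans aN.
have E : eval_coefs N (p :: ps) c =
    p ^+ a * (T a + p * \sum_(a.+1 <= b < N) p ^+ (b - a.+1) * T b).
  rewrite /= -(big_mkord xpredT (fun b => p ^+ b * T b))
    (big_cat_nat _ (n := a)) //=; last exact: ltnW.
  rewrite big_nat big1 ?add0r => [|b /andP[_ /T0->]]; last by rewrite mulr0.
  rewrite big_ltn // mulrDr; congr (_ + _); rewrite !big_distrr /= big_nat [RHS]big_nat.
  apply: eq_bigr => b /andP[ab _]; rewrite !mulrA -exprSr -exprD subnKC //.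
have Xn k : ~ (forall x, Z' x -> polyfun (p ^+ k) x = 0).
  elim: k => [|k IHk] pk0.
    case: irr' => [[x Zx] _]; have := pk0 x Zx.
    by rewrite /polyfun expr0 meval1 => /eqP; rewrite oner_eq0.
  by move: pk0; rewrite exprS => /(irreducible_mul irr')[].
have [] := irreducible_mul irr' (p := p ^+ a)
    (q := T a + p * \sum_(a.+1 <= b < N) p ^+ (b - a.+1) * T b).
- by move=> x /tw0; rewrite E.
- by move/Xn.
move=> q0; apply: (indep N (fun s => c (a :: s))) => // x Zx.
have := q0 x (ZZ' x Zx); rewrite /polyfun mevalD mevalM.
by have := p0 x Zx; rewrite /polyfun => ->; rewrite mul0r addr0.
Qed.

Lemma chain_alg_indep O m Zs : irreducible_chain O m Zs ->
  exists2 ps, size ps = m & alg_indep_on (Zs m) ps.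
Proof.
case=> irr strict; have: (m <= m)%N by [].
elim: {1 3 4}m => [_|k IHk lt_km].
  exists [::] => // N c c0 s /andP[/eqP/size0nil-> _].
  have [_ [[x Zx] _]] := irr 0 (leq0n _).
  by have := c0 x Zx; rewrite /polyfun /= mevalZ meval1 mulr1.
have [ps sz indep] := IHk (ltnW lt_km).
have [sub nsub] := strict k lt_km; have [_ irr'] := irr _ lt_km.
have [[C [P PC] ZC] _] := irr k (ltnW lt_km).
have [[C' _ ZC'] _] := irr k.+1 lt_km.
have [p [Pp pn0]] : exists p, P p /\ ~ (forall x, Zs k.+1 x -> polyfun p x = 0).
  apply: NNPP => N; apply: nsub => x Zx; apply/ZC; split; first by case/ZC': Zx.
  apply/PC => p Pp; apply: NNPP => px; apply: N; exists p; split=> // /(_ x Zx).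
  exact: px.
exists (p :: ps); first by rewrite /= sz.
apply: alg_indep_cons indep _ pn0 => // x /ZC[_ /PC]; exact.
Qed.

Section Parametrisation.
Hypothesis infK : forall s : seq K, exists x, x \notin s.
Variables (d : nat) (O : V -> Prop) (Phi : ('I_d -> K) -> V) (U : 'I_d -> V -> K).
Hypothesis Phi_poly : forall k, exists p : {mpoly K[d]}, forall t,
  coord (vbasis {:V}) k (Phi t) = p.@[t].
Hypothesis U_poly : forall j, is_polyfun (U j).
Hypothesis PhiK : forall t j, U j (Phi t) = t j.
Hypothesis OE : forall x, O x <-> exists t, x = Phi t.

(** Pulling back along Phi, as a morphism of polynomial algebras, so that it
carries relations between polynomials to relations. *)
Lemma polyfun_Phi : exists f : {lrmorphism PV -> {mpoly K[d]}},
  forall p t, polyfun p (Phi t) = (f p).@[t].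
Proof.
have [g gE] : exists g : 'I_(\dim {:V}) -> {mpoly K[d]},
    forall k t, coord (vbasis {:V}) k (Phi t) = (g k).@[t].
  exact: (fin_all_exists Phi_poly).
exists (comp_mpoly [tuple g k | k < _]) => p t.
rewrite comp_mpoly_meval; apply: meval_eq => k.
by rewrite tnth_mktuple gE.
Qed.

Lemma param_dim_le m Zs : irreducible_chain O m Zs -> (m <= d)%N.
Proof.
move=> ch; have [ps sz indep] := chain_alg_indep ch.
have [f fE] := polyfun_Phi; rewrite -sz leqNgt; apply/negP => lt_d.
have [|N [c [s [tw0 sN /eqP]]]] := algebraic_dependence (ps := map f ps).
  by rewrite size_map.
case; apply: (indep N); last by move: sN; rewrite size_map.
move=> x Zx; have /OE[t ->] : O x.
  by have [/(_ m (leqnn m))[[C _ ZC] _] _] := ch; have [] := (ZC x).1 Zx.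
by rewrite fE eval_coefs_morph tw0 meval0.
Qed.

Definition slice k x := exists2 t, (forall j : 'I_d, (k <= j)%N -> t j = 0) & x = Phi t.

(** If the slice is contained in neither C1 nor C2, two points a and b of the
coordinate subspace witness this with equations p1 and p2.  Along the line
through a and b both equations become nonzero univariate polynomials, and as
K is infinite some point of the line is outside both C1 and C2. *)
Lemma slice_irreducible k : irreducible (slice k).
Proof.
split; first by exists (Phi (fun=> 0)); exists (fun=> 0).
move=> C1 C2 [P1 C1E] [P2 C2E] cov; apply: NNPP => /not_or_and[n1 n2].
have sep C P : (forall x, C x <-> (forall p, P p -> polyfun p x = 0)) ->
    ~ subset_of (slice k) C ->
    exists t p, [/\ forall j : 'I_d, (k <= j)%N -> t j = 0, P p & polyfun p (Phi t) <> 0].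
  move=> CE nC; apply: NNPP => N; apply: nC => x [t t0 ->]; apply/CE => p Pp.
  by apply: NNPP => px; apply: N; exists t, p.
have [a [p1 [a0 Pp1 p1a]]] := sep _ _ C1E n1.
have [b [p2 [b0 Pp2 p2b]]] := sep _ _ C2E n2.
have [f fE] := polyfun_Phi.
pose line (s : K) j := a j + s * (b j - a j).
pose lp (p : PV) : {poly K} :=
  mmap (fun c => c%:P) (fun j => (a j)%:P + (b j - a j) *: 'X) (f p).
have lpE p s : (lp p).[s] = polyfun p (Phi (line s)).
  rewrite fE /lp /mmap horner_sum /meval /mmap; apply: eq_bigr => m _.
  rewrite hornerM hornerC; congr (_ * _).
  rewrite /mmap1 horner_prod; apply: eq_bigr => j _.
  by rewrite horner_exp hornerD hornerC hornerZ hornerX [_ * s]mulrC.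
have l1 : lp p1 != 0.
  apply/eqP => l0; apply: p1a; have := lpE p1 0; rewrite l0 horner0 => E.
  rewrite fE (meval_eq (v2 := line 0)) -?fE -?E // => j.
  by rewrite /line mul0r addr0.
have l2 : lp p2 != 0.
  apply/eqP => l0; apply: p2b; have := lpE p2 1; rewrite l0 horner0 => E.
  rewrite fE (meval_eq (v2 := line 1)) -?fE -?E // => j.
  by rewrite /line mul1r addrC subrK.
have [s sn] : exists s, ~~ root (lp p1 * lp p2) s.
  pose q := lp p1 * lp p2; have q0 : q != 0 by rewrite mulf_neq0.
  have [s us sz] : exists2 s : seq K, uniq s & size s = size q.
    elim: (size q) => [|l [s us sl]]; first by exists [::].
    by have [x xs] := infK s; exists (x :: s); rewrite /= ?xs ?us ?sl.
  have /allPn[x _ xr] : ~~ all (root q) s.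
    by apply/negP => /max_poly_roots-/(_ q0 us); rewrite sz ltnn.
  by exists x.
move: sn; rewrite rootE hornerM !lpE mulf_eq0 negb_or => /andP[/eqP e1 /eqP e2].
have [] := cov (Phi (line s)).
- exists (line s) => // j kj; by rewrite /line a0 // b0 // subrr mulr0 addr0.
- by move/C1E => /(_ _ Pp1).
- by move/C2E => /(_ _ Pp2).
Qed.

Lemma slice_closed k : closed_in O (slice k).
Proof.
exists (fun x => forall j : 'I_d, (k <= j)%N -> U j x = 0).
  exists (fun p => exists2 j : 'I_d, (k <= j)%N & forall x, U j x = polyfun p x) => x.
  split=> [x0 p [j kj <-]|x0 j kj]; first exact: x0.
  by have [p pE] := U_poly j; rewrite pE; apply: x0; exists j.
move=> x; split=> [[t t0 ->]|[/OE[t ->] t0]].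
  by split=> [|j kj]; [apply/OE; exists t | rewrite PhiK t0].
by exists t => // j /t0; rewrite PhiK.
Qed.

(** The inverse U of Phi is what makes the slices closed and distinct. *)
Theorem krull_dim_param : krull_dim O d.
Proof.
split; last exact: param_dim_le.
exists slice; split=> i id.
  by split; [exact: slice_closed | exact: slice_irreducible].
split=> [x [t t0 ->]|sub]; first by exists t => // j /ltnW/t0.
pose j0 := Ordinal id; pose t j : K := (j == j0)%:R.
have [|t' t'0] := sub (Phi t).
  exists t => // j ij; rewrite /t; case: eqP => // E.
  by move: ij; rewrite E ltnn.
move/(congr1 (U j0)); rewrite !PhiK t'0 // /t eqxx => /eqP.
by rewrite oner_eq0.
Qed.
End Parametrisation.
End Dim.

(** * The orbit as an iterated gluing of affine spaces *)

Section OrbitMatrices.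
Variables (n : nat) (K : fieldType) (w : posroot n -> K).
Implicit Types (xi eta : posroot n) (xs : seq (posroot n)) (A : {set 'I_n}).
Implicit Types (g h t X Y : 'M[K]_n).

(** A copy, among the n x n matrices, of the unitriangular group on the
indices A. *)
Definition UT_on A g := forall r c : 'I_n,
  [|| (r <= c)%N, r \notin A | c \notin A] -> g r c = (r == c)%:R.

Lemma UT_on_mul A g h : UT_on A g -> UT_on A h -> UT_on A (g *m h).
Proof.
move=> gU hU r c rc; rewrite mxE (bigD1 r) //= (gU r r) ?leqnn // eqxx mul1r (hU r c) //.
rewrite big1 ?addr0 // => k kr; case/or3P: rc => [rc|rA|cA].
- have [rk|kr'] := leqP r k; first by rewrite gU ?rk // eq_sym (negPf kr) mul0r.
  rewrite (hU k c) ?(leq_trans (ltnW kr')) // -val_eqE ltn_eqF ?mulr0 //.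
  exact: leq_trans rc.
- by rewrite gU ?rA ?orbT // eq_sym (negPf kr) mul0r.
- rewrite (hU k c) ?cA ?orbT //; case: (k =P c) => [kc|_]; last by rewrite mulr0.
  by rewrite mulr1 kc gU ?cA ?orbT // -kc eq_sym (negPf kr).
Qed.

(** The factor 1 + q ejT adds multiples of row j to other rows, and 1 - ei p
subtracts from row i a combination of other rows; the hypotheses say that
row j and column i of Y are zero, that p misses the index j and that q misses
the index i. *)
Lemma transvection_conj (a : K) Y (ei ej q : 'cV[K]_n) (eiT ejT p : 'rV[K]_n) :
  ejT *m ej = 1%:M -> eiT *m ei = 1%:M -> ejT *m ei = 0 ->
  eiT *m q = 0 -> p *m ej = 0 -> ejT *m Y = 0 -> Y *m ei = 0 ->
  (1%:M - ei *m p) *m (1%:M + q *m ejT) *m (a *: (ej *m eiT) + Y)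
    *m ((1%:M - q *m ejT) *m (1%:M + ei *m p)) =
  a *: ((ej + q - ei *m (p *m q)) *m (eiT + p)) + Y
    - (Y *m q - ei *m (p *m (Y *m q))) *m ejT - ei *m (p *m Y).
Proof.
move=> jj ii ji iq pj jY Yi.
pose N := a *: ((ej + q) *m eiT) + Y.
have S1 : (1%:M + q *m ejT) *m (a *: (ej *m eiT) + Y) = N.
  rewrite mulmxDl mul1mx -mulmxA [ejT *m (_ + _)]mulmxDr jY addr0 -!scalemxAr.
  by rewrite [ejT *m _]mulmxA jj mul1mx /N mulmxDl scalerDr addrAC.
have Nq : N *m q = Y *m q.
  by rewrite mulmxDl -scalemxAl -mulmxA iq mulmx0 scaler0 add0r.
have Nei : N *m ei = a *: (ej + q).
  by rewrite mulmxDl Yi addr0 -scalemxAl -mulmxA ii mulmx1.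
have S2 : N *m ((1%:M - q *m ejT) *m (1%:M + ei *m p)) =
    a *: ((ej + q) *m (eiT + p)) + Y - Y *m q *m ejT.
  rewrite mulmxA mulmxBr mulmx1 mulmxA Nq mulmxDr mulmx1 mulmxA mulmxBl Nei.
  rewrite -[Y *m q *m ejT *m ei]mulmxA ji mulmx0 subr0 -scalemxAl.
  by rewrite [(ej + q) *m (eiT + p)]mulmxDr scalerDr /N addrAC; congr (_ - _); rewrite addrAC.
rewrite -[_ *m _ *m (a *: _ + Y)]mulmxA S1 -mulmxA S2 mulmxBl mul1mx -[ei *m p *m _]mulmxA.
rewrite [p *m (_ + _ - _)]mulmxBr [p *m (_ + _)]mulmxDr -scalemxAr [p *m (_ *m (eiT + p))]mulmxA.
rewrite [p *m (ej + q)]mulmxDr pj add0r [p *m (_ *m ejT)]mulmxA.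
rewrite [ei *m (_ - _)]mulmxBr [ei *m (_ + _)]mulmxDr -scalemxAr [in RHS]mulmxBl.
rewrite [in RHS]mulmxBl scalerBr.
rewrite !mulmxA; set b1 := a *: _; set b2 := a *: _.
set b3 := Y *m q *m ejT; set b4 := _ *m ejT; set b5 := _ *m Y.
by apply/matrixP => r c; rewrite !mxE; ring.
Qed.

Definition arcs_mx xs : 'M[K]_n :=
  \sum_(xi <- xs) w xi *: delta_mx (root_j xi) (root_i xi).

Definition upper X : 'M[K]_n := \matrix_(r, c) if (r < c)%N then X r c else 0.

Definition orbit_mx A xs X := exists g h,
  [/\ UT_on A g, UT_on A h, g *m h = 1%:M & X = upper (g *m arcs_mx xs *m h)].

Lemma arcs_mx_conjE xs g h r c :
  (g *m arcs_mx xs *m h) r c =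
  \sum_(xi <- xs) w xi * (g r (root_j xi) * h (root_i xi) c).
Proof.
rewrite /arcs_mx mulmx_sumr mulmx_suml summxE; apply: eq_bigr => xi _.
rewrite -scalemxAr -scalemxAl mxE; congr (_ * _).
rewrite mxE (bigD1 (root_i xi)) //= big1 ?addr0 => [|k ki].
  rewrite mxE (bigD1 (root_j xi)) //= big1 ?addr0 => [|k kj].
    by rewrite mxE !eqxx mulr1.
  by rewrite mxE (negPf kj) mulr0.
by rewrite mxE big1 ?mul0r // => l _; rewrite mxE (negPf ki) andbF mulr0.
Qed.

Lemma arcs_conj_support A xs g h r c : arcs_on A xs -> UT_on A g -> UT_on A h ->
  (r \notin A) || (c \notin A) -> (g *m arcs_mx xs *m h) r c = 0.
Proof.
case/andP=> _ /allP inA gU hU rc; rewrite arcs_mx_conjE big_seq big1 // => eta /inA/andP[jA iA].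
case/orP: rc => nA.
  by rewrite gU ?nA ?orbT //; case: eqP nA => [->|_ _]; rewrite ?jA // mul0r mulr0.
by rewrite hU ?nA ?orbT //; case: eqP nA => [<-|_ _]; rewrite ?iA // mulr0 mulr0.
Qed.

Lemma orbit_mx_support A xs X (r c : 'I_n) : arcs_on A xs -> orbit_mx A xs X ->
  ~~ [&& (r < c)%N, r \in A & c \in A] -> X r c = 0.
Proof.
move=> on [g [h [gU hU _ ->]]]; rewrite mxE; case: ifP => //= _ rc.
by apply: arcs_conj_support on gU hU _; rewrite -negb_and.
Qed.

(** Clears column i by means of row j, then drops the indices of the arc. *)
Definition unglue A xi X : 'M[K]_n := \matrix_(r, c)
  if [&& (r < c)%N, r \in arc_rest A xi & c \in arc_rest A xi]
  then X r c - (w xi)^-1 * (X r (root_i xi) * X (root_j xi) c) else 0.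

(** The entries of t over the gap, in row j and in column i, are the free
coordinates contributed by the arc; dividing by the weight turns them into
row i of g^-1 and column j of g. *)
Definition glue_row A xi t : 'rV[K]_n :=
  \row_c if c \in arc_gap A xi then (w xi)^-1 * t (root_j xi) c else 0.

Definition glue_col A xi t : 'cV[K]_n :=
  \col_r if r \in arc_gap A xi then (w xi)^-1 * t r (root_i xi) else 0.

(** The upper part of the conjugate of w E_(j,i) + X by a unitriangular matrix
with prescribed column j and prescribed row i of its inverse; see
[transvection_conj].  The last term fills row i, which is determined by the
other rows because row i of g^-1 is orthogonal to the columns of g that carry
the later arcs. *)
Definition glue A xi t X : 'M[K]_n :=
  upper (w xi *: ((delta_mx (root_j xi) 0 + glue_col A xi t)
                  *m (delta_mx 0 (root_i xi) + glue_row A xi t))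
         + X - delta_mx (root_i xi) 0 *m (glue_row A xi t *m X)).

Section Step.
Variables (A : {set 'I_n}) (xi : posroot n) (xs : seq (posroot n)).
Hypothesis on : arcs_on A (xi :: xs).
Hypothesis w0 : w xi != 0.
Local Notation j := (root_j xi).
Local Notation i := (root_i xi).
Local Notation A' := (arc_rest A xi).

Let jA : j \in A. Proof. by case: (arcs_on_cons on). Qed.
Let iA : i \in A. Proof. by case: (arcs_on_cons on). Qed.
Let on' : arcs_on A' xs. Proof. by case: (arcs_on_cons on). Qed.
Let ji : (j < i)%N. Proof. exact: root_lt. Qed.

Lemma glueE t X (r c : 'I_n) : (r < c)%N ->
  glue A xi t X r c =
  w xi * (((r == j)%:R + glue_col A xi t r 0) * ((c == i)%:R + glue_row A xi t 0 c))
  + X r c - (r == i)%:R * \sum_k glue_row A xi t 0 k * X k c.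
Proof.
have E (a : K) (M N P : 'M[K]_n) : (a *: M + N - P) r c = a * M r c + N r c - P r c.
  by rewrite !mxE.
move=> rc; rewrite /glue mxE rc E; congr (_ * _ + _ - _).
  rewrite mxE big_ord1 [X in X * _]mxE [X in _ * X]mxE.
  by congr ((_ + _) * (_ + _)); rewrite mxE eqxx ?andbT.
by rewrite mxE big_ord1; congr (_ * _); rewrite mxE // eqxx andbT.
Qed.

Section Unglue.
Variables g h : 'M[K]_n.
Hypotheses (gU : UT_on A g) (hU : UT_on A h) (gh : g *m h = 1%:M).
Let Y := g *m arcs_mx xs *m h.
Let X := upper (g *m arcs_mx (xi :: xs) *m h).

Let YE r c : Y r c = \sum_(eta <- xs) w eta * (g r (root_j eta) * h (root_i eta) c).
Proof. exact: arcs_mx_conjE. Qed.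

Let XE (r c : 'I_n) : (r < c)%N -> X r c = w xi * (g r j * h i c) + Y r c.
Proof. by move=> rc; rewrite /X mxE rc arcs_mx_conjE big_cons YE. Qed.

Let Y_low (r c : 'I_n) : (r <= j)%N -> Y r c = 0.
Proof.
move=> rj; rewrite YE big_seq big1 // => eta etaX.
have lt : (r < root_j eta)%N.
  have /andP[_ /allP/(_ _ etaX)/andP[+ _]] := on'.
  by rewrite inE => /and3P[_ + _]; apply: leq_ltn_trans.
by rewrite gU ?(ltnW lt) // -val_eqE ltn_eqF //= mul0r mulr0.
Qed.

Let Y_out r c : (r \notin A) || (c \notin A) -> Y r c = 0.
Proof.
move=> rc; apply: arcs_conj_support gU hU rc.
have /andP[pw /allP inA] := on'; rewrite /arcs_on pw; apply/allP => eta /inA.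
by rewrite !inE => /andP[/andP[-> _] /andP[-> _]].
Qed.

Let hi1 : h i i = 1. Proof. by rewrite hU ?leqnn ?eqxx. Qed.
Let hi_gt (c : 'I_n) : (i < c)%N -> h i c = 0.
Proof. by move=> ic; rewrite hU ?(ltnW ic) // -val_eqE ltn_eqF. Qed.
Let gj1 : g j j = 1. Proof. by rewrite gU ?leqnn ?eqxx. Qed.

Let Xj (c : 'I_n) : (j < c)%N -> X j c = w xi * h i c.
Proof. by move=> jc; rewrite XE // Y_low // addr0 gj1 mul1r. Qed.

Let restP (c : 'I_n) : c \notin A' -> [\/ c = i, (c <= j)%N | c \notin A].
Proof.
rewrite inE; have [cA|] := boolP (c \in A); last by constructor 3.
by case: leqP => //= [|_ /negPn/eqP]; [constructor 2 | constructor 1].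
Qed.

Let unglueE (r c : 'I_n) : unglue A xi X r c =
  if [&& (r < c)%N, r \in A' & c \in A'] then Y r c - Y r i * h i c else 0.
Proof.
rewrite mxE; case: ifP => // /and3P[rc rA' cA'].
have /and3P[rA jr ri] : [&& r \in A, (j < r)%N & r != i] by move: rA'; rewrite inE.
have /and3P[cA jc ci] : [&& c \in A, (j < c)%N & c != i] by move: cA'; rewrite inE.
rewrite XE // Xj //; have [ci'|ic] := ltnP c i; last first.
  by rewrite hi_gt ?ltn_neqAle ?ic 1?eq_sym ?ci //; ring.
by rewrite XE ?(ltn_trans rc) // hi1; field.
Qed.

(** Write h = g^-1.  On the remaining indices the cleared matrix is
g' F' h' where g' is the restriction of g and h' r c = h r c - h r i * h i c.
These are inverse to each other: the correction by h i c cancels the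
contribution of the removed index i in the product h g, and the indices up to
j contribute nothing by triangularity. *)
Lemma orbit_unglue : orbit_mx A' xs (unglue A xi X).
Proof.
pose g' : 'M[K]_n := \matrix_(r, c)
  if (r \in A') && (c \in A') then g r c else (r == c)%:R.
pose h' : 'M[K]_n := \matrix_(r, c)
  if (r \in A') && (c \in A') then h r c - h r i * h i c else (r == c)%:R.
have h'g' : h' *m g' = 1%:M.
  apply/matrixP => k l; rewrite [RHS]mxE mxE.
  have [kA'|kA'] := boolP (k \in A'); last first.
    rewrite (bigD1 k) //= big1 => [|c ck].
      by rewrite !mxE (negPf kA') /= eqxx mul1r addr0.
    by rewrite mxE (negPf kA') /= eq_sym (negPf ck) mul0r.
  have [lA'|lA'] := boolP (l \in A'); last first.
    rewrite (bigD1 l) //= big1 => [|c cl].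
      by rewrite !mxE (negPf lA') !andbF eqxx mulr1 addr0.
    by rewrite [g' _ _]mxE (negPf lA') andbF (negPf cl) mulr0.
  have /and3P[lA jl li] : [&& l \in A, (j < l)%N & l != i] by move: lA'; rewrite inE.
  transitivity (\sum_c (h k c - h k i * h i c) * g c l).
    apply: eq_bigr => c _; rewrite !mxE kA' lA' andbT /=.
    case: ifPn => // cA'; have cl : c != l by apply: contraNneq cA' => ->.
    rewrite (negPf cl) mulr0; case: (restP cA') => [->|cj|cA].
    - by rewrite hi1 mulr1 subrr mul0r.
    - by rewrite gU ?(negPf cl) ?mulr0 // (leq_trans cj) // ltnW.
    - by rewrite gU ?(negPf cl) ?mulr0 // cA orbT.
  have hg := mulmx1C gh.
  have hgE a b : \sum_c h a c * g c b = (a == b)%:R.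
    by have := congr1 (fun M : 'M[K]_n => M a b) hg; rewrite !mxE.
  transitivity (\sum_c h k c * g c l - h k i * \sum_c h i c * g c l).
    by rewrite mulr_sumr -sumrB; apply: eq_bigr => c _; ring.
  by rewrite !hgE [i == l]eq_sym (negPf li) mulr0 subr0.
have g'U : UT_on A' g'.
  move=> r c rc; rewrite mxE; case: ifP => // /andP[rA' cA'].
  by move: rc; rewrite rA' cA' /= !orbF => rc; rewrite gU ?rc.
have h'U : UT_on A' h'.
  move=> r c rc; rewrite mxE; case: ifP => // /andP[rA' cA'].
  move: rc; rewrite rA' cA' /= !orbF => rc.
  have ri : r != i by move: rA'; rewrite inE => /and3P[].
  rewrite hU ?rc //; have [ri'|ir] := leqP r i.
    by rewrite (hU (r := r) (c := i)) ?ri' // (negPf ri) mul0r subr0.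
  by rewrite hi_gt ?mulr0 ?subr0 // (leq_trans ir).
exists g', h'; split=> //; first exact: mulmx1C.
apply/matrixP => r c; rewrite unglueE [RHS]mxE.
case: (ltnP r c) => //= rc; case: ifPn => [/andP[rA' cA']|rcA']; last first.
  by rewrite (arcs_conj_support on' g'U h'U) // -negb_and.
rewrite [RHS]arcs_mx_conjE !YE mulr_suml -sumrB big_seq [RHS]big_seq; apply: eq_bigr => eta etaX.
have /andP[_ /allP/(_ _ etaX)/andP[jA' iA']] := on'.
by rewrite ![in RHS]mxE rA' cA' jA' iA' /=; ring.
Qed.

Let X_out (r c : 'I_n) : (r < j)%N || (r \notin A) || (c \notin A) -> X r c = 0.
Proof.
have [rc|rc _] := ltnP r c; last by rewrite /X mxE ltnNge rc.
rewrite -orbA => /orP[rj|out]; last first.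
  by rewrite /X mxE rc (arcs_conj_support on gU hU).
have n0 : (r == j) = false by rewrite -val_eqE ltn_eqF.
by rewrite XE // Y_low ?(ltnW rj) // gU ?(ltnW rj) // n0 mul0r mulr0 addr0.
Qed.

Let row_gap k : glue_row A xi X 0 k = if k \in arc_gap A xi then h i k else 0.
Proof.
rewrite mxE inE; case: ifP => // /and3P[_ jk _].
by rewrite Xj // mulKf.
Qed.

(** Entrywise comparison; only row i is not immediate.  There the later arcs
contribute Y i c, and since row i of h is orthogonal to the columns of g at
the left ends of these arcs, the sum of the h i k * Y k c over all k
vanishes, which expresses Y i c through the rows of the gap. *)
Lemma glue_unglue : glue A xi X (unglue A xi X) = X.
Proof.
apply/matrixP => r c; have [rc|/negP rc] := boolP (r < c)%N; last first.
  by rewrite /glue /X !mxE; case: ifP => // /negP.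
have n0 (x y : 'I_n) : (x < y)%N -> (x == y) = false by move=> xy; rewrite -val_eqE ltn_eqF.
have n1 (x y : 'I_n) : (x < y)%N -> (y == x) = false by move=> xy; rewrite -val_eqE gtn_eqF.
rewrite glueE // row_gap.
have row_out k : k \notin arc_gap A xi -> glue_row A xi X 0 k = 0 by rewrite mxE => /negPf->.
have colE a : glue_col A xi X a 0 = if a \in arc_gap A xi then (w xi)^-1 * X a i else 0.
  by rewrite mxE.
have unglue_out (a b : 'I_n) : (a \notin A') || (b \notin A') -> unglue A xi X a b = 0.
  by rewrite unglueE -negb_and => /negPf ->; rewrite andbF.
have rest_A (a : 'I_n) : (a \in A') = [&& a \in A, (j < a)%N & a != i] by rewrite inE.
have gap_A (a : 'I_n) : (a \in arc_gap A xi) = [&& a \in A, (j < a)%N & (a < i)%N] by rewrite inE.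
have [rA|rA] := boolP (r \in A); last first.
  have rj : (r == j) = false by apply: contraNF rA => /eqP->.
  have ri : (r == i) = false by apply: contraNF rA => /eqP->.
  rewrite rj ri colE gap_A (negPf rA) /= unglue_out ?rest_A ?(negPf rA) //.
  by rewrite X_out ?rA ?orbT // /=; ring.
have [rj|jr|rj] := ltngtP r j.
- rewrite colE gap_A ltnNge (ltnW rj) /= andbF (n0 r j) // (n0 r i) ?(ltn_trans rj) //.
  rewrite unglue_out ?rest_A ?(ltnNge j r) ?(ltnW rj) ?andbF //.
  by rewrite X_out ?rj // /=; ring.
- rewrite (n1 j r) //.
  have jc : (j < c)%N by apply: ltn_trans rc.
  have [ri|ri] := eqVneq r i; last first.
    have rA' : r \in A' by rewrite rest_A rA jr ri.
    have [cA|cA] := boolP (c \in A); last first.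
      have ci : (c == i) = false by apply: contraNF cA => /eqP->.
      rewrite ci gap_A (negPf cA) unglue_out ?rest_A ?(negPf cA) ?orbT //.
      by rewrite X_out ?cA ?orbT // /=; ring.
    have [ci|ci] := eqVneq c i.
      have ri' : (r < i)%N by rewrite -ci.
      rewrite ci gap_A ltnn !andbF colE gap_A rA jr ri' /=.
      rewrite unglue_out ?rest_A ?eqxx ?andbF ?orbT //.
      by rewrite /=; field.
    have cA' : c \in A' by rewrite rest_A cA jc ci.
    rewrite [unglue _ _ _ _ _]mxE rc rA' cA' /= gap_A cA jc /=.
    have [ci'|ic] := ltnP c i; last first.
      by rewrite Xj // hi_gt ?ltn_neqAle ?ic 1?eq_sym ?ci // /=; ring.
    rewrite colE gap_A rA jr (ltn_trans rc ci') /= Xj //.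
    by rewrite /=; field.
  rewrite ri in rc jr rA *.
  rewrite colE gap_A ltnn !andbF (n1 i c) // gap_A (ltnNge c i) (ltnW rc) !andbF /=.
  rewrite unglue_out ?rest_A ?eqxx ?andbF //.
  have -> : \sum_k glue_row A xi X 0 k * unglue A xi X k c = - Y i c.
    have hY : \sum_k h i k * Y k c = 0.
      transitivity (\sum_(eta <- xs) \sum_k h i k * (w eta * (g k (root_j eta) * h (root_i eta) c))).
        by rewrite exchange_big; apply: eq_bigr => k _; rewrite YE mulr_sumr.
      rewrite big_seq big1 // => eta etaX.
      have ij : (i == root_j eta) = false.
        have /andP[_ /allP/(_ _ etaX)/andP[]] := on'.
        by rewrite rest_A => /and3P[_ _ /negPf]; rewrite eq_sym.
      have hgE : \sum_k h i k * g k (root_j eta) = 0.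
        have := congr1 (fun M : 'M[K]_n => M i (root_j eta)) (mulmx1C gh).
        by rewrite !mxE ij.
      transitivity (w eta * h (root_i eta) c * \sum_k h i k * g k (root_j eta)).
        by rewrite mulr_sumr; apply: eq_bigr => k _ /=; ring.
      by rewrite hgE mulr0.
    move: hY; rewrite (bigD1 i) //= hi1 mul1r => /eqP; rewrite addrC addr_eq0 => /eqP <-.
    rewrite [LHS](bigD1 i) //= row_gap gap_A ltnn !andbF mul0r add0r.
    apply: eq_bigr => k ki; rewrite row_gap; case: ifPn => [kg|].
      have /and3P[kA jk ki'] : [&& k \in A, (j < k)%N & (k < i)%N] by rewrite -gap_A.
      congr (_ * _); rewrite unglueE (ltn_trans ki' rc) rest_A kA jk ki /= rest_A.
      have [cA|cA] := boolP (c \in A); last by rewrite Y_out ?cA ?orbT.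
      by rewrite jc (n1 i c) //= hi_gt // mulr0 subr0.
    rewrite gap_A mul0r; have [kA /=|kA _] := boolP (k \in A); last first.
      by rewrite Y_out ?kA // mulr0.
    have [kj _|jk /=] := leqP k j; first by rewrite Y_low // mulr0.
    rewrite -leqNgt leq_eqVlt => /orP[/eqP/val_inj E|ik]; first by rewrite E eqxx in ki.
    by rewrite hi_gt // mul0r.
  rewrite XE // hi_gt // /=; ring.
- have {}rj : r = j by apply: val_inj.
  rewrite rj in rc rA *.
  rewrite eqxx (n0 j i) // colE gap_A ltnn !andbF /= unglue_out ?rest_A ?ltnn ?andbF //.
  rewrite Xj //; have [->|ci] := eqVneq c i.
    by rewrite gap_A ltnn !andbF hi1 /=; ring.
  rewrite gap_A rc; have [cA|cA] /= := boolP (c \in A); last first.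
    by rewrite hU ?cA ?orbT // eq_sym (negPf ci) /=; ring.
  case: ltnP => ic; first by rewrite /=; ring.
  by rewrite hi_gt ?ltn_neqAle ?ic 1?eq_sym ?ci // /=; ring.
Qed.

End Unglue.

(** X is the upper part of a conjugate Y of the matrix of the later arcs by
some g'; the arc itself is fixed by g', and the two transvections G1 and G2 then produce the
prescribed row and column.  The remaining terms of [transvection_conj] lie
below the diagonal. *)
Lemma orbit_glue t X : orbit_mx A' xs X -> orbit_mx A (xi :: xs) (glue A xi t X).
Proof.
case=> g' [h' [g'U h'U gh' XE]].
set Y := g' *m arcs_mx xs *m h' in XE.
have n0 (x y : 'I_n) : (x < y)%N -> (x == y) = false by move=> xy; rewrite -val_eqE ltn_eqF.
have n1 (x y : 'I_n) : (x < y)%N -> (y == x) = false by move=> xy; rewrite -val_eqE gtn_eqF.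
have sub g : UT_on A' g -> UT_on A g.
  move=> gU r c rc; apply: gU; case/or3P: rc => [->//|rA|cA]; rewrite !inE.
    by rewrite (negPf rA) orbT.
  by rewrite (negPf cA) !orbT.
have Yout (r c : 'I_n) : (r \notin A') || (c \notin A') -> Y r c = 0.
  exact: arcs_conj_support on' g'U h'U.
set p := glue_row A xi t; set q := glue_col A xi t.
pose ej : 'cV[K]_n := delta_mx j 0; pose ei : 'cV[K]_n := delta_mx i 0.
pose ejT : 'rV[K]_n := delta_mx 0 j; pose eiT : 'rV[K]_n := delta_mx 0 i.
have gapP (k : 'I_n) : k \in arc_gap A xi -> [/\ k \in A, (j < k)%N & (k < i)%N].
  by rewrite inE => /and3P[].
have p0 k : k \notin arc_gap A xi -> p 0 k = 0 by rewrite mxE => /negPf->.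
have q0 k : k \notin arc_gap A xi -> q k 0 = 0 by rewrite mxE => /negPf->.
have jgap : j \notin arc_gap A xi by rewrite inE ltnn andbF.
have igap : i \notin arc_gap A xi by rewrite inE ltnn !andbF.
have mul_ei m (M : 'M[K]_(m, n)) : M *m ei = col i M by rewrite -colE.
have mul_ej m (M : 'M[K]_(m, n)) : M *m ej = col j M by rewrite -colE.
have eiT_mul m (M : 'M[K]_(n, m)) : eiT *m M = row i M by rewrite -rowE.
have ejT_mul m (M : 'M[K]_(n, m)) : ejT *m M = row j M by rewrite -rowE.
have jq : ejT *m q = 0 by apply/matrixP => a b; rewrite ejT_mul ord1 [b]ord1 mxE q0 // mxE.
have iq : eiT *m q = 0 by apply/matrixP => a b; rewrite eiT_mul ord1 [b]ord1 mxE q0 // mxE.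
have pj : p *m ej = 0 by apply/matrixP => a b; rewrite mul_ej ord1 [b]ord1 mxE p0 // mxE.
have pi : p *m ei = 0 by apply/matrixP => a b; rewrite mul_ei ord1 [b]ord1 mxE p0 // mxE.
have jY : ejT *m Y = 0.
  by apply/matrixP => a b; rewrite ejT_mul mxE Yout ?mxE // inE ltnn andbF.
have Yi : Y *m ei = 0.
  by apply/matrixP => a b; rewrite mul_ei mxE Yout ?mxE // !inE eqxx !andbF orbT.
have jj : ejT *m ej = 1%:M.
  by apply/matrixP => a b; rewrite ejT_mul ord1 [b]ord1 !mxE !eqxx.
have ii : eiT *m ei = 1%:M.
  by apply/matrixP => a b; rewrite eiT_mul ord1 [b]ord1 !mxE !eqxx.
have ji0 : ejT *m ei = 0.
  by apply/matrixP => a b; rewrite ejT_mul !mxE n0.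
pose G1 := 1%:M - ei *m p; pose G1' := 1%:M + ei *m p.
pose G2 := 1%:M + q *m ejT; pose G2' := 1%:M - q *m ejT.
have eip r c : (ei *m p) r c = (r == i)%:R * p 0 c.
  by rewrite mxE big_ord1 [ei _ _]mxE eqxx andbT.
have qej r c : (q *m ejT) r c = (c == j)%:R * q r 0.
  by rewrite mxE big_ord1 [ejT _ _]mxE mulrC.
have eip0 (r c : 'I_n) : [|| (r <= c)%N, r \notin A | c \notin A] -> (ei *m p) r c = 0.
  move=> rc; rewrite eip; case: eqP => [ri|_]; last by rewrite mul0r.
  rewrite p0 ?mulr0 //; apply: contraL rc => /gapP[cA jc ci].
  by rewrite ri iA cA orbF -ltnNge.
have qej0 (r c : 'I_n) : [|| (r <= c)%N, r \notin A | c \notin A] -> (q *m ejT) r c = 0.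
  move=> rc; rewrite qej; case: eqP => [cj|_]; last by rewrite mul0r.
  rewrite q0 ?mulr0 //; apply: contraL rc => /gapP[rA jr ri].
  by rewrite cj jA rA orbF -ltnNge.
have G1U : UT_on A G1 by move=> r c rc; rewrite 3!mxE eip0 // subr0.
have G1'U : UT_on A G1' by move=> r c rc; rewrite 2!mxE eip0 // addr0.
have G2U : UT_on A G2 by move=> r c rc; rewrite 2!mxE qej0 // addr0.
have G2'U : UT_on A G2' by move=> r c rc; rewrite 3!mxE qej0 // subr0.
have G1K : G1 *m G1' = 1%:M.
  rewrite mulmxBl mul1mx mulmxDr mulmx1 -[ei *m p *m _]mulmxA [p *m (ei *m p)]mulmxA.
  by rewrite pi mul0mx mulmx0 addr0 addrK.
have G2K : G2 *m G2' = 1%:M.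
  rewrite mulmxDl mul1mx mulmxBr mulmx1 -[q *m ejT *m _]mulmxA [ejT *m (q *m _)]mulmxA.
  by rewrite jq mul0mx mulmx0 subr0 subrK.
have g'ej : g' *m ej = ej.
  apply/matrixP => r c; rewrite mul_ej !mxE ord1 eqxx andbT.
  by rewrite g'U // !inE ltnn !andbF !orbT.
have eih' : eiT *m h' = eiT.
  apply/matrixP => r c; rewrite eiT_mul !mxE ord1 eqxx /= [c == i]eq_sym.
  by rewrite h'U // !inE eqxx !andbF orbT.
exists (G1 *m G2 *m g'), (h' *m (G2' *m G1')); split.
- by apply: UT_on_mul (sub _ g'U); apply: UT_on_mul.
- by apply: UT_on_mul (sub _ h'U) _; apply: UT_on_mul.
- rewrite -!mulmxA [g' *m _]mulmxA gh' mul1mx [G2 *m _]mulmxA G2K mul1mx.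
  exact: G1K.
have FE : g' *m arcs_mx (xi :: xs) *m h' = w xi *: (ej *m eiT) + Y.
  rewrite /arcs_mx big_cons -/(arcs_mx xs) mulmxDr mulmxDl -/Y; congr (_ + _).
  rewrite -scalemxAr -scalemxAl; congr (_ *: _).
  have -> : delta_mx j i = ej *m eiT :> 'M[K]_n by rewrite mul_delta_mx.
  by rewrite mulmxA g'ej -mulmxA eih'.
have -> : G1 *m G2 *m g' *m arcs_mx (xi :: xs) *m (h' *m (G2' *m G1')) =
    G1 *m G2 *m (w xi *: (ej *m eiT) + Y) *m (G2' *m G1').
  by rewrite -FE !mulmxA.
rewrite transvection_conj //; apply/matrixP => r c.
have [rc|rc] := ltnP r c; last by rewrite !mxE ltnNge rc.
rewrite glueE // [RHS]mxE rc.
have E (a : K) (M1 M2 M3 M4 : 'M[K]_n) :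
    (a *: M1 + M2 - M3 - M4) r c = a * M1 r c + M2 r c - M3 r c - M4 r c.
  by rewrite !mxE.
rewrite E {E} [((ej + q - _) *m _) r c]mxE big_ord1
  [(_ *m ejT) r c]mxE big_ord1 [(ei *m _) r c]mxE big_ord1.
have -> : (eiT + p) 0 c = (c == i)%:R + p 0 c by rewrite mxE [eiT _ _]mxE eqxx.
have eiE a : ei r a = (r == i)%:R by rewrite mxE ord1 eqxx andbT.
have ejTE a : ejT a c = (c == j)%:R by rewrite mxE ord1 eqxx.
have -> : (ej + q - ei *m (p *m q)) r 0 = (r == j)%:R + q r 0 - (r == i)%:R * (p *m q) 0 0.
  rewrite mxE [(- (ei *m _)) _ _]mxE [(ej + q) _ _]mxE [ej _ _]mxE eqxx andbT; congr (_ + _ - _).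
  by rewrite mxE big_ord1 eiE.
have -> : (Y *m q - ei *m (p *m (Y *m q))) r 0 = (Y *m q) r 0 - (r == i)%:R * (p *m (Y *m q)) 0 0.
  by rewrite mxE [(- (ei *m _)) _ _]mxE; congr (_ - _); rewrite mxE big_ord1 eiE.
rewrite eiE ejTE XE [upper Y r c]mxE rc.
have ic : (r == i)%:R * ((c == i)%:R + p 0 c) = 0 :> K.
  case: eqP => [ri|]; rewrite ?mul0r // mul1r p0; last first.
    by apply: contraTN rc => /gapP[_ _ ci]; rewrite ri -leqNgt ltnW.
  by rewrite (n1 i c) ?addr0 // -ri.
have jc : (c == j)%:R * ((Y *m q) r 0 - (r == i)%:R * (p *m (Y *m q)) 0 0) = 0.
  case: eqP => [cj|]; rewrite ?mul0r // mul1r.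
  have rA' : r \notin A' by rewrite inE -cj ltnNge (ltnW rc) andbF.
  rewrite (n0 r i) ?(ltn_trans _ ji) -?cj // mul0r subr0 mxE big1 // => k _.
  by rewrite Yout ?rA' // mul0r.
have pY : (r == i)%:R * (\sum_k p 0 k * upper Y k c) = (r == i)%:R * (p *m Y) 0 c.
  case: eqP => [ri|]; rewrite ?mul0r // !mul1r mxE; apply: eq_bigr => k _.
  have [kg|kg] := boolP (k \in arc_gap A xi); last by rewrite p0 // !mul0r.
  have [_ _ ki] := gapP _ kg; by rewrite [upper _ _ _]mxE (ltn_trans ki) // -ri.
rewrite pY; symmetry.
transitivity (w xi * (((r == j)%:R + q r 0) * ((c == i)%:R + p 0 c))
    - w xi * (p *m q) 0 0 * ((r == i)%:R * ((c == i)%:R + p 0 c)) + Y r c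
    - (c == j)%:R * ((Y *m q) r 0 - (r == i)%:R * (p *m (Y *m q)) 0 0)
    - (r == i)%:R * (p *m Y) 0 c); first by ring.
by rewrite ic jc mulr0 !subr0.
Qed.

Lemma glue_row_entry t X k : orbit_mx A' xs X -> k \in arc_gap A xi ->
  glue A xi t X j k = t j k.
Proof.
move=> XO kg; have := kg; rewrite inE => /and3P[kA jk ki].
have jn : j \notin A' by rewrite inE ltnn andbF.
rewrite glueE // eqxx [glue_col _ _ _ _ _]mxE inE ltnn andbF [glue_row _ _ _ _ k]mxE kg.
rewrite (orbit_mx_support on' XO) ?(negPf jn) ?andbF //.
rewrite -!val_eqE /= (ltn_eqF ki) (ltn_eqF ji) /=.
by field.
Qed.

Lemma glue_col_entry t X k : orbit_mx A' xs X -> k \in arc_gap A xi ->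
  glue A xi t X k i = t k i.
Proof.
move=> XO kg; have := kg; rewrite inE => /and3P[kA jk ki].
have jn : i \notin A' by rewrite inE eqxx !andbF.
rewrite glueE // eqxx [glue_row _ _ _ _ i]mxE inE ltnn !andbF [glue_col _ _ _ k _]mxE kg.
rewrite (orbit_mx_support on' XO) ?(negPf jn) ?andbF //.
rewrite -!val_eqE /= (ltn_eqF ki) (gtn_eqF jk) /=.
by field.
Qed.

Lemma unglue_glue t X : orbit_mx A' xs X -> unglue A xi (glue A xi t X) = X.
Proof.
move=> XO; apply/matrixP => r c; rewrite mxE; case: ifPn => [/and3P[rc rA' cA']|out]; last first.
  by rewrite (orbit_mx_support on' XO).
have /and3P[rA jr ri] : [&& r \in A, (j < r)%N & r != i] by move: rA'; rewrite inE.
have /and3P[cA jc ci] : [&& c \in A, (j < c)%N & c != i] by move: cA'; rewrite inE.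
have rj : (r == j) = false by rewrite -val_eqE gtn_eqF.
have jn : j \notin A' by rewrite inE ltnn andbF.
have in_ : i \notin A' by rewrite inE eqxx !andbF.
have q0 : glue_col A xi t j 0 = 0 by rewrite mxE inE ltnn andbF.
have p0 : glue_row A xi t 0 i = 0 by rewrite mxE inE ltnn !andbF.
have -> : glue A xi t X j c = w xi * glue_row A xi t 0 c.
  rewrite glueE // q0 eqxx (negPf ci) (orbit_mx_support on' XO) ?(negPf jn) ?andbF //.
  by rewrite -!val_eqE /= (ltn_eqF ji) /=; ring.
have -> : glue A xi t X r i = w xi * glue_col A xi t r 0.
  have [ri'|ri'|/val_inj E] := ltngtP r i; last by rewrite E eqxx in ri.
    rewrite glueE // p0 eqxx rj (negPf ri) (orbit_mx_support on' XO) ?(negPf in_) ?andbF //=.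
    by ring.
  by rewrite mxE ltnNge (ltnW ri') /= mxE inE (ltnNge r i) (ltnW ri') !andbF mulr0.
rewrite glueE // rj (negPf ri) (negPf ci) /=.
by field.
Qed.

End Step.

(** Polynomial functions of the entries of a matrix.  The inductive form
makes polynomiality of the recursively defined charts a matter of closure
properties, whatever the number of coordinates; it is converted into genuine
multivariate polynomials by [entry_poly_comp]. *)
Inductive entry_poly : ('M[K]_n -> K) -> Prop :=
| EntryPolyVar r c : entry_poly (fun X => X r c)
| EntryPolyConst a : entry_poly (fun=> a)
| EntryPolyAdd u v : entry_poly u -> entry_poly v -> entry_poly (fun X => u X + v X)
| EntryPolyMul u v : entry_poly u -> entry_poly v -> entry_poly (fun X => u X * v X)
| EntryPolyExt u v : entry_poly u -> u =1 v -> entry_poly v.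

Definition entrywise_poly (F : 'M[K]_n -> 'M[K]_n) :=
  forall r c, entry_poly (fun X => F X r c).

Record fun_subalg (T : Type) (P : (T -> K) -> Prop) : Prop := FunSubalg {
  subalg_const : forall a, P (fun=> a);
  subalg_add : forall u v, P u -> P v -> P (fun x => u x + v x);
  subalg_mul : forall u v, P u -> P v -> P (fun x => u x * v x);
  subalg_ext : forall u v, P u -> u =1 v -> P v }.

(** Used with P the polynomial functions of matrix entries, of a parameter in
K^d, and of a vector of the dual space. *)
Lemma entry_poly_comp T P (M : T -> 'M[K]_n) u : fun_subalg P -> entry_poly u ->
  (forall r c, P (fun x => M x r c)) -> P (fun x => u (M x)).
Proof.
case=> Pc Pa Pm Pe up PM; elim: u / up => // [u v _ Pu _ Pv|u v _ Pu _ Pv|u v _ Pu uv].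
- exact: Pa.
- exact: Pm.
- by apply: Pe Pu _ => x.
Qed.

Lemma entry_poly_subalg : fun_subalg entry_poly.
Proof.
split; [exact: EntryPolyConst | exact: EntryPolyAdd | exact: EntryPolyMul | exact: EntryPolyExt].
Qed.

Lemma subalg_sum T P I (s : seq I) (F : I -> T -> K) : fun_subalg P ->
  (forall k, P (F k)) -> P (fun x => \sum_(k <- s) F k x).
Proof.
case=> Pc Pa Pm Pe PF; elim: s => [|k s IH].
  by apply: Pe (Pc 0) _ => x; rewrite big_nil.
by apply: Pe (Pa _ _ (PF k) IH) _ => x; rewrite big_cons.
Qed.

Lemma subalg_opp T P (u : T -> K) : fun_subalg P -> P u -> P (fun x => - u x).
Proof.
by case=> Pc _ Pm Pe Pu; apply: Pe (Pm _ _ (Pc (-1)) Pu) _ => x; rewrite mulN1r.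
Qed.

Lemma glue_poly A xi (F : 'M[K]_n -> 'M[K]_n) : entrywise_poly F ->
  entrywise_poly (fun t => glue A xi t (F t)).
Proof.
move=> FP r c; have sub := entry_poly_subalg; have [Pc Pa Pm Pe] := sub.
have [rc|rc] := boolP (r < c)%N; last first.
  by apply: Pe (Pc 0) _ => t; rewrite mxE (negPf rc).
have pP k : entry_poly (fun t => glue_row A xi t 0 k).
  have [kg|kg] := boolP (k \in arc_gap A xi).
    apply: Pe (Pm _ _ (Pc (w xi)^-1) (EntryPolyVar (root_j xi) k)) _ => t.
    by rewrite mxE kg.
  by apply: Pe (Pc 0) _ => t; rewrite mxE (negPf kg).
have qP k : entry_poly (fun t => glue_col A xi t k 0).
  have [kg|kg] := boolP (k \in arc_gap A xi).
    apply: Pe (Pm _ _ (Pc (w xi)^-1) (EntryPolyVar k (root_i xi))) _ => t.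
    by rewrite mxE kg.
  by apply: Pe (Pc 0) _ => t; rewrite mxE (negPf kg).
have E t : w xi * (((r == root_j xi)%:R + glue_col A xi t r 0) *
      ((c == root_i xi)%:R + glue_row A xi t 0 c)) + F t r c
    + - ((r == root_i xi)%:R * \sum_k glue_row A xi t 0 k * F t k c) =
    glue A xi t (F t) r c by rewrite glueE.
apply: Pe E; apply: (Pa); first apply: (Pa).
- by apply: (Pm) => //; apply: (Pm); apply: (Pa).
- exact: FP.
- apply: subalg_opp => //; apply: (Pm) => //.
  by apply: subalg_sum => // k; apply: Pm.
Qed.

Lemma unglue_poly A xi : entrywise_poly (unglue A xi).
Proof.
move=> r c; have sub := entry_poly_subalg; have [Pc Pa Pm Pe] := sub.
have [inside|/negPf out] := boolP [&& (r < c)%N, r \in arc_rest A xi & c \in arc_rest A xi];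
  last by apply: Pe (Pc 0) _ => X; rewrite mxE out.
have E X : X r c + - ((w xi)^-1 * (X r (root_i xi) * X (root_j xi) c)) = unglue A xi X r c.
  by rewrite mxE inside.
apply: Pe E; apply: (Pa); first exact: EntryPolyVar.
apply: subalg_opp => //; apply: (Pm) => //.
by apply: (Pm); apply: EntryPolyVar.
Qed.

(** A polynomial isomorphism from the affine space of functions on the set B
of matrix positions onto O, with polynomial inverse.  Points of that affine
space are represented by matrices, of which only the entries in B count. *)
Record chart (O : 'M[K]_n -> Prop) (B : {set 'I_n * 'I_n}) (Phi U : 'M[K]_n -> 'M[K]_n)
    : Prop := Chart {
  chart_poly : entrywise_poly Phi;
  chart_inv_poly : entrywise_poly U;
  chart_local : forall t t', (forall p, p \in B -> t p.1 p.2 = t' p.1 p.2) -> Phi t = Phi t';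
  chart_in : forall t, O (Phi t);
  chart_K : forall t p, p \in B -> U (Phi t) p.1 p.2 = t p.1 p.2;
  chart_invK : forall X, O X -> Phi (U X) = X }.

(** The arc adds to the positions of the later arcs those of row j and of
column i over its gap; none of them lies in the square of the remaining
indices, which contains the old ones. *)
Lemma orbit_mx_chart A xs : arcs_on A xs -> (forall xi, xi \in xs -> w xi != 0) ->
  exists (B : {set 'I_n * 'I_n}) Phi U, [/\ #|B| = arcs_dim A xs, B \subset setX A A
    & chart (orbit_mx A xs) B Phi U].
Proof.
have sub := entry_poly_subalg; have [Pc Pa Pm Pe] := sub.
elim: xs A => [|xi xs IH] A on w0.
  exists set0, (fun=> 0), (fun=> 0); split; rewrite ?cards0 ?sub0set //.
  have nilE X : orbit_mx A [::] X -> X = 0.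
    case=> g [h [_ _ _ ->]]; rewrite /arcs_mx big_nil mulmx0 mul0mx.
    by apply/matrixP => r c; rewrite !mxE; case: ifP.
  split=> //; try by move=> r c; apply: Pe (Pc 0) _ => X; rewrite mxE.
  - move=> _; exists 1%:M, 1%:M; split; rewrite ?mulmx1 ?mul1mx //;
      try by move=> r c _; rewrite mxE.
    rewrite /arcs_mx big_nil.
    by apply/matrixP => r c; rewrite !mxE; case: ifP.
  - by move=> t p; rewrite inE.
  - by move=> X /nilE->.
have [jA iA on'] := arcs_on_cons on.
have wxi : w xi != 0 by apply: w0; rewrite inE eqxx.
have [|B' [Phi' [U' [cardB' subB' ch']]]] := IH _ on'.
  by move=> eta etaX; apply: w0; rewrite inE etaX orbT.
set j := root_j xi; set i := root_i xi; set G := arc_gap A xi.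
pose R := [set (j, k) | k in G]; pose C := [set (k, i) | k in G].
have rest_sub p : p \in B' -> [/\ p.1 \in arc_rest A xi & p.2 \in arc_rest A xi].
  by move/(subsetP subB'); rewrite inE => /andP[].
have jn : j \notin arc_rest A xi by rewrite inE ltnn andbF.
have in_ : i \notin arc_rest A xi by rewrite inE eqxx !andbF.
have gA k : k \in G -> k \in A by rewrite inE => /andP[].
have RC0 : R :&: C = set0.
  apply/setP => p; rewrite !inE; apply/negP => /andP[/imsetP[k kG ->] /imsetP[l lG [E _]]].
  by move: lG; rewrite -E inE ltnn andbF.
have RB0 : (R :|: C) :&: B' = set0.
  apply/setP => p; rewrite !inE; apply/negP => /andP[/orP[]/imsetP[k kG ->] /rest_sub[]] /=.
    by rewrite (negPf jn).
  by rewrite (negPf in_).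
have notnew p : p \in B' -> (p \in R :|: C) = false.
  move=> pB; apply/negP => pRC; have := in_set0 p.
  by rewrite -RB0 inE pRC pB.
pose U X : 'M[K]_n := \matrix_(r, c)
  if (r, c) \in R :|: C then X r c else U' (unglue A xi X) r c.
exists (R :|: C :|: B'), (fun t => glue A xi t (Phi' t)), U; split.
- rewrite cardsU RB0 cards0 subn0 cardsU RC0 cards0 subn0 cardB' /=.
  by rewrite !card_imset ?addnn ?mul2n //; move=> k l [].
- rewrite !subUset -andbA; apply/and3P; split.
  + by apply/subsetP => _ /imsetP[k /gA kA ->]; rewrite inE jA.
  + by apply/subsetP => _ /imsetP[k /gA kA ->]; rewrite inE iA kA.
  + by apply/subsetP => p /rest_sub[]; rewrite !inE => /andP[-> _] /andP[-> _].
have [pP iP loc inO cK ciK] := ch'; split.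
- exact: glue_poly.
- move=> r c; case: (boolP ((r, c) \in R :|: C)) => rc.
    by apply: Pe (EntryPolyVar r c) _ => X; rewrite mxE rc.
  apply: Pe (entry_poly_comp sub (iP r c) (unglue_poly A xi)) _ => X.
  by rewrite mxE (negPf rc).
- move=> t t' tt'; have -> : Phi' t = Phi' t'.
    by apply: loc => p pB; apply: tt'; rewrite inE pB orbT.
  rewrite /glue; have -> : glue_row A xi t = glue_row A xi t'.
    apply/rowP => k; rewrite !mxE; case: ifP => // kG; congr (_ * _).
    by apply: (tt' (j, k)); rewrite !inE imset_f.
  have -> // : glue_col A xi t = glue_col A xi t'.
  apply/colP => k; rewrite !mxE; case: ifP => // kG; congr (_ * _).
  by apply: (tt' (k, i)); rewrite !inE [X in _ || X || _]imset_f ?orbT.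
- by move=> t; apply: orbit_glue.
- move=> t p; rewrite !inE -orbA => /or3P[/imsetP[k kG ->]|/imsetP[k kG ->]|pB] /=.
  + by rewrite mxE inE imset_f //= (glue_row_entry on).
  + by rewrite mxE inE [X in _ || X]imset_f ?orbT //= (glue_col_entry on).
  + by rewrite mxE -surjective_pairing notnew // (unglue_glue on) // cK.
- move=> X [g [h [gU hU gh XE]]].
  have XU : unglue A xi X = Phi' (U X).
    rewrite -[LHS]ciK; last by rewrite XE; apply: orbit_unglue.
    by apply: loc => p pB; rewrite [RHS]mxE -surjective_pairing notnew.
  rewrite -XU; have XK : glue A xi X (unglue A xi X) = X by rewrite {3}XE XE glue_unglue.
  rewrite -[RHS]XK /glue.
  have -> : glue_row A xi (U X) = glue_row A xi X.
    apply/rowP => k; rewrite !mxE; case: ifP => // kG; congr (_ * _).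
    by rewrite inE imset_f.
  have -> // : glue_col A xi (U X) = glue_col A xi X.
  apply/colP => k; rewrite !mxE; case: ifP => // kG; congr (_ * _).
  by rewrite inE [X in _ || X]imset_f ?orbT.
Qed.

End OrbitMatrices.

(** * Linear forms as matrices, and the dimension of the orbit *)

Section Dual.
Variables (n : nat) (K : fieldType).
Local Notation nilp := (subvs_of (ut n K)).
Local Notation dual := 'Hom(nilp, K^o).
Implicit Types (f h : dual) (X Y g : 'M[K]_n) (xi : posroot n).

Definition dual_mx f : 'M[K]_n := \matrix_(r, c)
  if insub (r, c) is Some xi then f (ydelta K xi) else 0.

Lemma dual_mxE f xi : dual_mx f (root_j xi) (root_i xi) = f (ydelta K xi).
Proof. by rewrite mxE -surjective_pairing valK. Qed.

Lemma dual_mx_upper f : upper (dual_mx f) = dual_mx f.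
Proof.
apply/matrixP => r c; rewrite !mxE; case: insubP => [xi /= lt _|/negPf /= ->] //.
by rewrite lt.
Qed.

Lemma sum_posroot (Z : nmodType) (F : 'I_n -> 'I_n -> Z) :
  (forall r c : 'I_n, (c <= r)%N -> F r c = 0) ->
  \sum_r \sum_c F r c = \sum_(xi : posroot n) F (root_j xi) (root_i xi).
Proof.
move=> F0; rewrite pair_bigA /= (bigID (fun p : 'I_n * 'I_n => (p.1 < p.2)%N)) /= addrC.
rewrite big1 ?add0r => [|p]; last by rewrite -leqNgt => /F0.
rewrite (reindex_omap (val : posroot n -> 'I_n * 'I_n) insub) => [|p lt]; last first.
  by rewrite /= insubT.
by apply: eq_bigl => xi; rewrite (valP xi) valK eqxx.
Qed.

Lemma nilp_sum (x : nilp) :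
  x = \sum_(xi : posroot n) vsval x (root_i xi) (root_j xi) *: ydelta K xi.
Proof.
apply: val_inj; rewrite /= linear_sum /= [LHS]matrix_sum_delta exchange_big /=.
rewrite sum_posroot => [|r c cr]; last by rewrite (mem_utP _ (subvsP x)) ?scale0r.
by apply: eq_bigr => xi _; rewrite -ydeltaE.
Qed.

Lemma dual_traceE f x : f x = \tr (dual_mx f *m vsval x).
Proof.
rewrite /mxtrace; under eq_bigr => r _ do rewrite mxE.
rewrite sum_posroot => [|r c cr]; last first.
  by rewrite (mem_utP _ (subvsP x)) ?mulr0.
rewrite {1}(nilp_sum x) linear_sum; apply: eq_bigr => xi _.
by rewrite linearZ /= dual_mxE mulrC.
Qed.

Lemma dual_mx_inj : injective dual_mx.
Proof. by move=> f h fh; apply/lfunP => x; rewrite !dual_traceE fh. Qed.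

Lemma upper_eq X Y : (forall xi, X (root_j xi) (root_i xi) = Y (root_j xi) (root_i xi)) ->
  upper X = upper Y.
Proof.
move=> XY; apply/matrixP => r c; rewrite !mxE; case: ifP => // rc.
exact: (XY (Sub (r, c) rc)).
Qed.

(** The trace form turns precomposition with conjugation into conjugation,
up to the lower triangular part, which the strictly lower triangular matrices
do not see. *)
Lemma dual_mx_coAd g f : g \in @UT n K ->
  dual_mx (coAd g f) = upper (g *m dual_mx f *m invmx g).
Proof.
move=> gU; rewrite -dual_mx_upper; apply: upper_eq => xi.
rewrite dual_mxE comp_lfunE dual_traceE Ad_valE ?UT_inv // invmxK ydeltaE.
transitivity (\tr (delta_mx (root_i xi) (root_j xi) *m (g *m dual_mx f *m invmx g))).
  by rewrite [RHS]mxtrace_mulC -!mulmxA [RHS]mxtrace_mulC -!mulmxA.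
rewrite /mxtrace (bigD1 (root_i xi)) //= big1 ?addr0 => [|k ki]; last first.
  by rewrite mxE big1 // => l _; rewrite mxE (negPf ki) mul0r.
rewrite mxE (bigD1 (root_j xi)) //= big1 ?addr0 => [|k kj]; last first.
  by rewrite mxE (negPf kj) andbF mul0r.
by rewrite mxE !eqxx mul1r.
Qed.

Definition entry_fun xi (x : nilp) : K^o := vsval x (root_i xi) (root_j xi).

Fact entry_fun_is_linear xi : linear (entry_fun xi).
Proof. by move=> a x y; rewrite /entry_fun linearP !mxE. Qed.

HB.instance Definition _ xi := GRing.isLinear.Build K nilp K^o _ (entry_fun xi)
  (entry_fun_is_linear xi).

Definition mx_dual X : dual :=
  \sum_(xi : posroot n) X (root_j xi) (root_i xi) *: linfun (entry_fun xi).

Lemma posroot_eq xi eta : root_j xi = root_j eta -> root_i xi = root_i eta -> xi = eta.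
Proof.
case: xi eta => -[? ?] ? [[? ?] ?]; rewrite /root_j /root_i /= => ? ?.
by apply: val_inj => /=; congr (_, _).
Qed.

Lemma mx_dualK X : dual_mx (mx_dual X) = upper X.
Proof.
rewrite -dual_mx_upper; apply: upper_eq => xi; rewrite dual_mxE.
rewrite /mx_dual sum_lfunE (bigD1 xi) //= big1 => [|eta ne].
  by rewrite scale_lfunE lfunE /= /entry_fun ydeltaE mxE !eqxx addr0 [LHS]mulr1.
rewrite scale_lfunE lfunE /= /entry_fun ydeltaE mxE.
case: eqP => [ei|_]; last by rewrite scaler0.
case: eqP => [ej|_]; last by rewrite scaler0.
by rewrite (posroot_eq ej ei) eqxx in ne.
Qed.

Lemma arcs_on_uniq A (xs : seq (posroot n)) : arcs_on A xs -> uniq xs.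
Proof.
case/andP=> + _; elim: xs => //= xi xs IH /andP[/allP before /IH->].
by rewrite andbT; apply/negP => /before; rewrite /arc_before ltnn.
Qed.

Lemma dual_mx_arcs f (xs : seq (posroot n)) : uniq xs ->
  (forall xi, xi \notin xs -> f (ydelta K xi) = 0) ->
  dual_mx f = arcs_mx (fun xi => f (ydelta K xi)) xs.
Proof.
move=> uxs f0; rewrite -dual_mx_upper; set F := arcs_mx _ xs.
have FE r c : F r c = \sum_(eta <- xs) f (ydelta K eta) *
    ((r == root_j eta) && (c == root_i eta))%:R.
  by rewrite /F /arcs_mx summxE; apply: eq_bigr => eta _; rewrite !mxE.
have -> : F = upper F.
  apply/matrixP => r c; rewrite [RHS]mxE; case: ltnP => // cr.
  rewrite FE big1 // => eta _; case: eqP => [E1|]; last by rewrite mulr0.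
  case: eqP => [E2|]; last by rewrite mulr0.
  by have := root_lt eta; rewrite -E1 -E2 ltnNge cr.
apply: upper_eq => xi; rewrite dual_mxE FE.
have other eta : eta != xi ->
    (root_j xi == root_j eta) && (root_i xi == root_i eta) = false.
  by move=> ne; apply: contraNF ne => /andP[/eqP ej /eqP ei]; rewrite (posroot_eq ej ei).
have [xiX|xiX] := boolP (xi \in xs).
  rewrite (bigD1_seq xi) //= !eqxx mulr1 big1 ?addr0 // => eta /other->.
  by rewrite mulr0.
rewrite f0 // big_seq big1 // => eta etaX; rewrite other ?mulr0 //.
by apply: contraNneq xiX => <-.
Qed.

End Dual.

Lemma pchar0_infinite (K : fieldType) : [pchar K] =i pred0 ->
  forall s : seq K, exists x, x \notin s.
Proof.
move=> /pcharf0P K0 s; pose r := [seq k%:R : K | k <- iota 0 (size s).+1].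
have ur : uniq r.
  rewrite map_inj_uniq ?iota_uniq // => k l.
  wlog le : k l / (k <= l)%N.
    by move=> W; have [/W //|/ltnW/W E] := leqP k l; move/esym/E/esym.
  move/eqP; rewrite eq_sym -subr_eq0 -natrB // K0 subn_eq0 => lk.
  by apply/eqP; rewrite eqn_leq le.
have /allPn[x _ xs] : ~~ all (mem s) r; last by exists x.
apply/negP => /allP rs; have := uniq_leq_size ur rs.
by rewrite size_map size_iota ltnn.
Qed.

Lemma is_polyfun_subalg (K : fieldType) (V : vectType K) : fun_subalg (@is_polyfun K V).
Proof.
split=> [a|u v [p pE] [q qE]|u v [p pE] [q qE]|u v [p pE] uv].
- by exists a%:MP => x; rewrite /polyfun mevalC.
- by exists (p + q) => x; rewrite pE qE /polyfun mevalD.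
- by exists (p * q) => x; rewrite pE qE /polyfun mevalM.
- by exists p => x; rewrite -uv.
Qed.

Lemma linear_is_polyfun (K : fieldType) (V : vectType K) (u : V -> K) :
  linear (u : V -> K^o) -> is_polyfun u.
Proof.
move=> u_lin; pose uL := GRing.isLinear.Build K V K^o _ _ u_lin.
pose ul : {linear V -> K^o} := HB.pack (u : V -> K^o) uL.
exists (\sum_(k < \dim {:V}) u (vbasis {:V})`_k *: 'X_k) => x.
rewrite /polyfun raddf_sum -[u x]/(ul x) {1}(coord_vbasis (memvf x)) linear_sum.
by apply: eq_bigr => k _; rewrite [LHS]linearZ /= mevalZ mevalXU [LHS]mulrC.
Qed.

Lemma meval_subalg (K : fieldType) d :
  fun_subalg (fun u : ('I_d -> K) -> K => exists p : {mpoly K[d]}, forall t, u t = p.@[t]).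
Proof.
split=> [a|u v [p pE] [q qE]|u v [p pE] [q qE]|u v [p pE] uv].
- by exists a%:MP => x; rewrite mevalC.
- by exists (p + q) => x; rewrite pE qE mevalD.
- by exists (p * q) => x; rewrite pE qE mevalM.
- by exists p => x; rewrite -uv.
Qed.

Definition place n (K : fieldType) (B : {set 'I_n * 'I_n}) (t : 'I_#|B| -> K) : 'M[K]_n :=
  \matrix_(r, c) \sum_(k < #|B| | enum_val k == (r, c)) t k.

Lemma placeE n (K : fieldType) (B : {set 'I_n * 'I_n}) (t : 'I_#|B| -> K) k :
  place t (enum_val k).1 (enum_val k).2 = t k.
Proof.
rewrite mxE -surjective_pairing (big_pred1 k) // => l.
by apply/eqP/eqP => [/enum_val_inj|->].
Qed.

(** Transports a chart of matrices to the dual space, where the Krull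
dimension is taken with respect to the coordinates in a basis. *)
Lemma krull_dim_chart n (K : fieldType) (O : nilp_dual n K -> Prop)
    (O' : 'M[K]_n -> Prop) B Phi U :
  [pchar K] =i pred0 -> (forall h, O h <-> O' (dual_mx h)) ->
  (forall X, O' X -> upper X = X) -> chart O' B Phi U -> krull_dim O #|B|.
Proof.
move=> charK OE up [PhiP UP loc inO UK KU].
have subP := meval_subalg K #|B|; have subV := is_polyfun_subalg (nilp_dual n K).
have dual_mxK X : O' X -> dual_mx (mx_dual X) = X by move=> /up {2}<-; rewrite mx_dualK.
apply: (krull_dim_param (pchar0_infinite charK)
  (Phi := fun t => mx_dual (Phi (place t)))
  (U := fun k h => U (dual_mx h) (enum_val k).1 (enum_val k).2)).
- move=> k.
  have entryP r c : exists p : {mpoly K[#|B|]}, forall t, Phi (place t) r c = p.@[t].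
    apply: (entry_poly_comp subP (PhiP r c)) => a b.
    exists (\sum_(l < #|B| | enum_val l == (a, b)) 'X_l) => t.
    by rewrite mxE raddf_sum; apply: eq_bigr => l _; rewrite /= mevalXU.
  have [p pE] := subalg_sum (index_enum (posroot n))
    (F := fun xi (t : 'I_#|B| -> K) => Phi (place t) (root_j xi) (root_i xi) *
       coord (vbasis {:nilp_dual n K}) k (linfun (entry_fun (K:=K) xi))) subP
    (fun xi => subalg_mul subP (entryP _ _) (subalg_const subP _)).
  exists p => t; rewrite -pE /mx_dual linear_sum.
  by apply: eq_bigr => xi _; rewrite linearZ.
- move=> k; apply: (entry_poly_comp subV (UP _ _)) => r c.
  have [rc|rc] := boolP (r < c)%N; last first.
    apply: (subalg_ext subV (subalg_const subV 0)) => h.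
    by rewrite mxE insubN.
  pose xi : posroot n := Sub (r, c) rc.
  apply: (subalg_ext subV (u := fun h : nilp_dual n K => h (ydelta K xi))).
    by apply: linear_is_polyfun => a h h'; rewrite add_lfunE scale_lfunE.
  by move=> h; rewrite -dual_mxE.
- by move=> t k; rewrite dual_mxK // UK ?enum_valP // placeE.
- move=> h; split=> [/OE hO|[t ->]]; last by apply/OE; rewrite dual_mxK.
  exists (fun k => U (dual_mx h) (enum_val k).1 (enum_val k).2).
  apply: dual_mx_inj; rewrite dual_mxK // -[LHS]KU //; apply: loc => p pB.
  by rewrite -[p](enum_rankK_in pB pB) placeE.
Qed.

Theorem theorem1p2 (n : nat) (K : fieldType) (charK : [pchar K] =i pred0)
    (sigma : 'S_n) (sigma2 : (sigma ^+ 2 = 1)%g)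
    (f : nilp_dual n K) (fX : Xset sigma f) :
  krull_dim (orbit_coAd f) (simple_length sigma - reflection_length sigma)%N.
Proof.
case: fX => xis [/reflection_decomposition_arcs[on ->] f1 f0].
pose w (xi : posroot n) : K := f (ydelta K xi).
rewrite length_diff_arcs //.
have [B [Phi [U [<- _ ch]]]] := orbit_mx_chart (w := w) on f1.
apply: (krull_dim_chart (O := orbit_coAd f) charK _ _ ch); last first.
  move=> _ [g [h [_ _ _ ->]]]; apply/matrixP => r c.
  by rewrite [LHS]mxE [in RHS]mxE; case: ifP => // rc; rewrite mxE rc.
have fE : dual_mx f = arcs_mx w xis by apply: dual_mx_arcs (arcs_on_uniq on) f0.
move=> h; split=> [[g gU ->]|[g [g' [gU g'U gg' hE]]]].
  exists g, (invmx g); split.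
  - by move=> r c; rewrite !inE !orbF; apply: (UTP _ gU).
  - by move=> r c; rewrite !inE !orbF; apply: (UTP _ (UT_inv gU)).
  - by rewrite mulmxV // UT_unit.
  - by rewrite dual_mx_coAd // fE.
have gUT : g \in @UT n K by apply/UTP => r c rc; rewrite gU // rc.
exists g => //; apply: dual_mx_inj; rewrite dual_mx_coAd // hE fE.
suff -> : invmx g = g' by [].
by rewrite -[LHS]mulmx1 -gg' mulmxA mulVmx ?mul1mx // UT_unit.
Qed.
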